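(* Let $n\ge 1$ and $c>0$. Consider the representation of the complex Lie algebra $so(2n+1)$ by difference operators on meromorphic functions of the variables $\nu_{ab}$ described in the context, together with the elements $F_{k,k+1},F_{k+1,k}$ ($1\le k\le n$) and the functions $w_n,w_n'$ defined there. Then $w_n$ and $w_n'$ are left and right Whittaker vectors for $SO(2n+1)$: $$F_{k,k+1}w_n=\frac{(-1)^{k+1}}{ic}\,w_n\quad (1\le k<n),\qquad F_{n,n+1}w_n=\frac{(-1)^{n+1}}{\sqrt2\, ic}\,w_n,$$ $$F_{k+1,k}w'_n=\frac{(-1)^{k+1}}{ic}\,w'_n\quad (1\le k<n),\qquad F_{n+1,n}w'_n=\frac{(-1)^{n+1}}{\sqrt2\, ic}\,w'_n .$$
   Context: Here $i=\sqrt{-1}$ and $c>0$. Variables: for $1\le a\le 2n$ let $\boldsymbol\nu_a=\{\nu_{a,j}\}$, where $\boldsymbol\nu_{2k}=\{\nu_{2k,1},\dots,\nu_{2k,k}\}$ and $\boldsymbol\nu_{2k-1}=\{\nu_{2k-1,1},\dots,\nu_{2k-1,k}\}$ ($\boldsymbol\nu_0$ and $\boldsymbol\nu_{-1}$ are empty; empty products equal 1, empty sums 0). $e^{\pm ic\,\partial_{\nu_{a,j}}}$ is the shift $\nu_{a,j}\mapsto \nu_{a,j}\pm ic$. The Lie algebra $so(2n+1)$ has basis $I_{ab}=e_{ab}-e_{ba}$, $a>b$ ($e_{ab}$ matrix units), and is generated by $I_{a+1,a}$, $1\le a\le 2n$. It acts on meromorphic functions by $$I_{2k+1,2k}=-\frac1{ic}\sum_{j=1}^{k}\frac{\prod_{r=1}^{k-1}(\nu_{2k-2,r}+\nu_{2k-1,j}+\frac{ic}2)\prod_{r=1}^{k}(\nu_{2k-1,j}-\nu_{2k,r}+\frac{ic}2)}{2\prod_{r\ne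 j}(\nu_{2k-1,j}-\nu_{2k-1,r})(\nu_{2k-1,j}+\nu_{2k-1,r}+ic)}\,e^{ic\partial_{\nu_{2k-1,j}}}$$ $$\qquad-\frac1{ic}\sum_{j=1}^{k}\frac{\prod_{r=1}^{k-1}(\nu_{2k-1,j}-\nu_{2k-2,r}-\frac{ic}2)\prod_{r=1}^{k}(\nu_{2k,r}+\nu_{2k-1,j}-\frac{ic}2)}{2\prod_{r\ne j}(\nu_{2k-1,j}-\nu_{2k-1,r})(\nu_{2k-1,j}+\nu_{2k-1,r}-ic)}\,e^{-ic\partial_{\nu_{2k-1,j}}}\qquad(1\le k\le n),$$ $$I_{2k+2,2k+1}=\frac1{ic}\sum_{j=1}^{k}\frac{\prod_{r=1}^{k+1}((\nu_{2k,j}+\frac{ic}2)^2-\nu_{2k+1,r}^2)}{2\nu_{2k,j}(\nu_{2k,j}+\frac{ic}2)\prod_{r\ne j}(\nu_{2k,j}^2-\nu_{2k,r}^2)}\,e^{ic\partial_{\nu_{2k,j}}}$$ $$\qquad+\frac1{ic}\sum_{j=1}^{k}\frac{\prod_{r=1}^{k}((\nu_{2k,j}-\frac{ic}2)^2-\nu_{2k-1,r}^2)}{2\nu_{2k,j}(\nu_{2k,j}-\frac{ic}2)\prod_{r\ne j}(\nu_{2k,j}^2-\nu_{2k,r}^2)}\,e^{-ic\partial_{\nu_{2k,j}}}+\frac1c\,\frac{\prod_{r=1}^{k}\nu_{2k-1,r}\prod_{r=1}^{k+1}\nu_{2k+1,r}}{\prod_{r=1}^{k}(\nu_{2k,r}^2+\frac{c^2}4)}\qquad(0\le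 k\le n-1).$$ The other basis elements act through commutators: $I_{a+2,a}=[I_{a+2,a+1},I_{a+1,a}]$, $I_{a+3,a}=[I_{a+3,a+1},I_{a+1,a}]$. Simple root generators: for $1\le k\le n-1$, $$F_{k,k+1}=\tfrac12(I_{2k+1,2k}-I_{2k+2,2k-1})+\tfrac i2(I_{2k+2,2k}+I_{2k+1,2k-1}),$$ $$F_{k+1,k}=\tfrac12(I_{2k+2,2k-1}-I_{2k+1,2k})+\tfrac i2(I_{2k+2,2k}+I_{2k+1,2k-1}),$$ and $$F_{n,n+1}=\tfrac1{\sqrt2}(I_{2n+1,2n}+iI_{2n+1,2n-1}),\qquad F_{n+1,n}=\tfrac1{\sqrt2}(-I_{2n+1,2n}+iI_{2n+1,2n-1}).$$ For finite sets $X,Y$ of variables put $$s(X;Y)=\prod_{x\in X,\,y\in Y}(ic)^{\frac{x+y}{ic}}\,\Gamma\Big(\frac{x+y}{ic}+\frac12\Big),\qquad (ic)^z=e^{z(\log c+i\pi/2)},$$ and $-X=\{-x:x\in X\}$. For a sign $\pm$ define $$W_k^{\pm}=e^{\mp\frac{\pi}{2c}\sum_j\nu_{2k,j}}\,s(\pm\boldsymbol\nu_{2k-1};\boldsymbol\nu_{2k})\,s(-\boldsymbol\nu_{2k};\pm\boldsymbol\nu_{2k+1}),\qquad V_k^{\pm}=e^{\mp\frac{\pi}{2c}\sum_j\nu_{2k,j}}\,s(\pm\boldsymbol\nu_{2k-1};\boldsymbol\nu_{2k}),$$ and, with $\delta_{2n}=\sum_j\nu_{2n,j}$, $$w_n=e^{-\frac{\pi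 n}{2c}\delta_{2n}}\,W_1^{+}W_2^{-}\cdots W_{n-1}^{(-1)^{n}}V_n^{(-1)^{n+1}},\qquad w_n'=e^{-\frac{\pi n}{2c}\delta_{2n}}\,W_1^{-}W_2^{+}\cdots W_{n-1}^{(-1)^{n-1}}V_n^{(-1)^{n}},$$ where a superscript $(-1)^m$ denotes the sign $+$ if $m$ is even and $-$ if $m$ is odd.
   Formalization: The printed signs fail for odd index (e.g. n=1: F_{1,2}w_1=-w_1/(√2 ic)); the formal theorem has eigenvalue -1/(ic) for all 1≤k<n and -1/(√2 ic) for the last generator, for both w_n and w'_n, which agrees with the printed values for even index. *)

(* Defs.v *)
From HB Require Import structures.
From mathcomp Require Import all_boot all_order all_algebra.
From mathcomp Require Import all_classical all_reals all_analysis.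
From mathcomp Require Import complex.

Set Implicit Arguments.
Unset Strict Implicit.
Unset Printing Implicit Defensive.

Import Order.TTheory GRing.Theory Num.Theory.
Import numFieldNormedType.Exports.

Local Open Scope classical_set_scope.
Local Open Scope ring_scope.
Local Open Scope complex_scope.

Definition cexp (R : realType) (z : R[i]) : R[i] :=
  (expR (complex.Re z))%:C * (cos (complex.Im z) +i* sin (complex.Im z)).

(* Euler's limit m! m^z / (z (z+1) ... (z+m)).  At a pole z = 0, -1, -2, ...
   the quotients are eventually 0, so that cGamma takes the value 0 there. *)
Definition cGamma (R : realType) (z : R[i]) : R[i] :=
  lim ((fun m : nat => (m`!%:R * cexp (z * (ln m%:R)%:C)
                        / \prod_(0 <= k < m.+1) (z + k%:R) : R[i]^o)) @ \oo).

(* (a, j) with a : 'I_(2 * n), j : 'I_(uphalf a.+1) stands for nu_{a+1,j+1};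
   the group nu_a has uphalf a members. *)
Definition gtidx (n : nat) : finType := {a : 'I_(2 * n) & 'I_(uphalf a.+1)}.

Definition nu_label (n : nat) (p : gtidx n) : nat * nat :=
  ((tag p).+1, (tagged p).+1).

Definition nu_space (R : realType) (n : nat) : topologicalType :=
  'rV[R[i]^o]_#|gtidx n|.

(* nu_{a,j}, with 1 <= a <= 2n and 1 <= j <= uphalf a (0 for other labels). *)
Definition nu (R : realType) (n : nat) (x : nu_space R n) (a j : nat) : R[i] :=
  if [pick p : gtidx n | nu_label p == (a, j)] is Some p
  then x 0 (enum_rank p) else 0.

Definition nu_shift (R : realType) (n : nat) (a j : nat) (d : R[i])
    (x : nu_space R n) : nu_space R n :=
  \row_q (x 0 q + (if nu_label (enum_val q) == (a, j) then d else 0)).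

(* A meromorphic function is represented by a total function, whose values on
   the polar set are irrelevant (division by 0 yields 0): meromorphic
   functions are equal when they agree on a dense open set.  This relation is
   compatible with sums, products and shifts, hence with the operators
   below. *)
Definition mero_eq (R : realType) (n : nat) (f g : nu_space R n -> R[i]) :
    Prop :=
  exists U : set (nu_space R n),
    [/\ open U, dense U & forall x, U x -> f x = g x].

Definition operator (R : realType) (n : nat) : Type :=
  (nu_space R n -> R[i]) -> (nu_space R n -> R[i]).

Definition op_comm (R : realType) (n : nat) (A B : operator R n) :
    operator R n :=
  fun f x => A (B f) x - B (A f) x.

Section Representation.

Variables (R : realType) (n : nat) (c : R).

Definition ic : R[i] := 'i * c%:C.

(* I_{2k+1,2k} *)
Definition I_odd (k : nat) : operator R n := fun f x =>
  - ic^-1 * (\sum_(1 <= j < k.+1)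
      (\prod_(1 <= r < k) (nu x (2 * k - 2) r + nu x (2 * k - 1) j + ic / 2)
       * \prod_(1 <= r < k.+1) (nu x (2 * k - 1) j - nu x (2 * k) r + ic / 2))
      / (2 * \prod_(1 <= r < k.+1 | r != j)
           ((nu x (2 * k - 1) j - nu x (2 * k - 1) r)
            * (nu x (2 * k - 1) j + nu x (2 * k - 1) r + ic)))
      * f (nu_shift (2 * k - 1) j ic x))
  - ic^-1 * (\sum_(1 <= j < k.+1)
      (\prod_(1 <= r < k) (nu x (2 * k - 1) j - nu x (2 * k - 2) r - ic / 2)
       * \prod_(1 <= r < k.+1) (nu x (2 * k) r + nu x (2 * k - 1) j - ic / 2))
      / (2 * \prod_(1 <= r < k.+1 | r != j)
           ((nu x (2 * k - 1) j - nu x (2 * k - 1) r)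
            * (nu x (2 * k - 1) j + nu x (2 * k - 1) r - ic)))
      * f (nu_shift (2 * k - 1) j (- ic) x)).

(* I_{2k+2,2k+1} *)
Definition I_even (k : nat) : operator R n := fun f x =>
  ic^-1 * (\sum_(1 <= j < k.+1)
      \prod_(1 <= r < k.+2)
        ((nu x (2 * k) j + ic / 2) ^+ 2 - nu x (2 * k + 1) r ^+ 2)
      / (2 * nu x (2 * k) j * (nu x (2 * k) j + ic / 2)
         * \prod_(1 <= r < k.+1 | r != j)
             (nu x (2 * k) j ^+ 2 - nu x (2 * k) r ^+ 2))
      * f (nu_shift (2 * k) j ic x))
  + ic^-1 * (\sum_(1 <= j < k.+1)
      \prod_(1 <= r < k.+1)
        ((nu x (2 * k) j - ic / 2) ^+ 2 - nu x (2 * k - 1) r ^+ 2)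
      / (2 * nu x (2 * k) j * (nu x (2 * k) j - ic / 2)
         * \prod_(1 <= r < k.+1 | r != j)
             (nu x (2 * k) j ^+ 2 - nu x (2 * k) r ^+ 2))
      * f (nu_shift (2 * k) j (- ic) x))
  + (c^-1)%:C
    * ((\prod_(1 <= r < k.+1) nu x (2 * k - 1) r
        * \prod_(1 <= r < k.+2) nu x (2 * k + 1) r)
       / \prod_(1 <= r < k.+1) (nu x (2 * k) r ^+ 2 + (c ^+ 2 / 4)%:C))
    * f x.

(* I_{a+1,a} *)
Definition I_simple (a : nat) : operator R n :=
  if odd a then I_even a./2 else I_odd a./2.

(* I_{a+d+1,a} = [I_{a+d+1,a+1}, I_{a+1,a}] for d > 0. *)
Fixpoint I_gap (d a : nat) : operator R n :=
  if d is d'.+1 then op_comm (I_gap d' a.+1) (I_simple a) else I_simple a.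

(* The action of I_{ba} = e_{ba} - e_{ab}, for b > a. *)
Definition I_ (b a : nat) : operator R n := I_gap (b - a).-1 a.

(* F_{k,k+1}, for 1 <= k <= n.  The sign of the k-th generator depends on the
   normalization of the action: so(2n+1) has the automorphism changing the
   sign of I_{2k+1,2k} for all odd k (1 <= k <= n), which multiplies F_{k,k+1}
   and F_{k+1,k} by (-1)^k. *)
Definition F_up (k : nat) : operator R n := fun f x =>
  if (k < n)%N then
    2^-1 * (I_ (2 * k + 1) (2 * k) f x - I_ (2 * k + 2) (2 * k - 1) f x)
    + 'i / 2 * (I_ (2 * k + 2) (2 * k) f x + I_ (2 * k + 1) (2 * k - 1) f x)
  else
    ((Num.sqrt 2)^-1)%:C * (I_ (2 * n + 1) (2 * n) f x
                            + 'i * I_ (2 * n + 1) (2 * n - 1) f x).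

(* F_{k+1,k}, for 1 <= k <= n *)
Definition F_down (k : nat) : operator R n := fun f x =>
  if (k < n)%N then
    2^-1 * (I_ (2 * k + 2) (2 * k - 1) f x - I_ (2 * k + 1) (2 * k) f x)
    + 'i / 2 * (I_ (2 * k + 2) (2 * k) f x + I_ (2 * k + 1) (2 * k - 1) f x)
  else
    ((Num.sqrt 2)^-1)%:C * (- I_ (2 * n + 1) (2 * n) f x
                            + 'i * I_ (2 * n + 1) (2 * n - 1) f x).

(* (ic)^z *)
Definition ic_pow (z : R[i]) : R[i] := cexp (z * (ln c +i* (pi / 2))).

Definition s_fun (X Y : seq R[i]) : R[i] :=
  \prod_(x <- X) \prod_(y <- Y)
    (ic_pow ((x + y) / ic) * cGamma ((x + y) / ic + 1 / 2)).

Definition nu_group (x : nu_space R n) (a : nat) : seq R[i] :=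
  [seq nu x a j | j <- iota 1 (uphalf a)].

Definition seq_scale (e : R[i]) (X : seq R[i]) : seq R[i] :=
  [seq e * x | x <- X].

(* V_k^{+-} and W_k^{+-}, the sign being e = 1 or e = -1. *)
Definition V_factor (k : nat) (e : R[i]) (x : nu_space R n) : R[i] :=
  cexp (- e * (pi / (2 * c))%:C * \sum_(1 <= j < k.+1) nu x (2 * k) j)
  * s_fun (seq_scale e (nu_group x (2 * k - 1))) (nu_group x (2 * k)).

Definition W_factor (k : nat) (e : R[i]) (x : nu_space R n) : R[i] :=
  V_factor k e x
  * s_fun (seq_scale (-1) (nu_group x (2 * k)))
          (seq_scale e (nu_group x (2 * k + 1))).

Definition delta_factor (x : nu_space R n) : R[i] :=
  cexp (- (pi * n%:R / (2 * c))%:C * \sum_(1 <= j < n.+1) nu x (2 * n) j).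

Definition whittaker_w (x : nu_space R n) : R[i] :=
  delta_factor x * (\prod_(1 <= k < n) W_factor k ((-1) ^+ (k + 1)) x)
  * V_factor n ((-1) ^+ (n + 1)) x.

Definition whittaker_w' (x : nu_space R n) : R[i] :=
  delta_factor x * (\prod_(1 <= k < n) W_factor k ((-1) ^+ k) x)
  * V_factor n ((-1) ^+ n) x.

End Representation.

(* Main.v *)
Require Import Defs.
From HB Require Import structures.
From mathcomp Require Import all_boot all_order all_algebra.
From mathcomp Require Import all_classical all_reals all_analysis.
From mathcomp Require Import complex ring lra zify.
Set Implicit Arguments.
Unset Strict Implicit.
Unset Printing Implicit Defensive.
Import Order.TTheory GRing.Theory Num.Theory.
Import numFieldNormedType.Exports.
Local Open Scope ring_scope.
Local Open Scope complex_scope.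

(* Fix k, write h = ic, A = I_{2k+1,2k}, B = I_{2k,2k-1}, C = I_{2k+2,2k+1},
   and let s = 1 for F_{k,k+1}, w_n and s = -1 for F_{k+1,k}, w_n'.  As B and C
   commute, the generator is (s/2) (1 + s i [C, -]) (1 + s i [-, B]) A for k < n,
   and (s/sqrt 2) (1 + s i [-, B]) A for k = n.  Each
   term a T of A shifts one variable of nu_{2k-1} by h or -h, and Gamma's
   functional equation makes every operator act on the Whittaker function by
   multiplication with rational functions; the two commutators then multiply
   the term a T by factors X (from C) and Y (from B) which are sums over the
   nodes z = -h/2, +-nu_{2k,l} (resp. +-nu_{2k-2,l}), the node -h/2 accounting
   for the summand of C (resp. B) without shift.  These sums are evaluated by
   Lagrange interpolation: for one of the two directions of the shift Y = 0,
   for the other one X = 2 and Y is a product.  What is left is a sum over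
   the variables of nu_{2k-1}, again given by Lagrange interpolation.

   Identities are proved at the points whose coordinates have nonzero real
   parts with pairwise distinct squares: this set is open and dense, stable
   under the shifts by +-h because h is imaginary, and no denominator vanishes
   on it. *)

(** * The functional equation of Gamma *)

Section Gamma.
Local Open Scope classical_set_scope.
Variable R : realType.
Implicit Types z w : R[i].

Lemma cexpD z w : cexp (z + w) = cexp z * cexp w.
Proof.
case: z => a b; case: w => x y; rewrite /cexp /= expRD cosD sinD.
by simpc; congr (_ +i* _); ring.
Qed.

Lemma cexp_real (x : R) : cexp x%:C = (expR x)%:C.
Proof. by rewrite /cexp /= cos0 sin0; simpc. Qed.

Lemma real_complex_continuous : continuous (real_complex R : R^o -> R[i]^o).
Proof.
move=> x; apply/cvgrPdist_lt => e e0.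
have e0' : 0 < complex.Re e by move: e0; rewrite ltcE /= => /andP[].
(* A positive element of [R[i]] is real, which reduces the estimate to one in [R]. *)
have eE : e = (complex.Re e)%:C.
  by move: e0; rewrite ltcE /= => /andP[/eqP h _]; case: e h {e0'} => a b /= ->.
near=> y.
have -> : x%:C - y%:C = (x - y)%:C by rewrite rmorphB.
rewrite normc_def /=. rewrite [in X in _ + X]expr0n /= addr0 sqrtr_sqr eE ltcR.
near: y.
by have /cvgrPdist_lt := @cvg_id _ (nbhs (x : R^o)); apply.
Unshelve. all: by end_near.
Qed.

Lemma cvg_invn_complex :
  ((fun m : nat => (m%:R)^-1 : R[i]^o) @ \oo --> (0 : R[i]^o))%classic.
Proof.
rewrite -(@cvg_shiftS (R[i]^o)) /=.
have -> : (fun m : nat => (m.+1%:R)^-1 : R[i]^o)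
        = (real_complex R : R^o -> R[i]^o) \o (@harmonic R).
  by apply/funext => m; rewrite /= /harmonic /= fmorphV rmorph_nat.
apply: (@cvg_comp _ _ _ _ _ _ (nbhs (0 : R^o))); first exact: cvg_harmonic.
exact: real_complex_continuous.
Qed.

(* For a divergent sequence [lim] is the default point 0, so that convergence
   need not be established. *)
Lemma lim_mul_seq (K : numFieldType) (u v r : nat -> K^o) (l : K^o) : l != 0 ->
    r @ \oo --> l ->
    (forall m, (0 < m)%N -> r m != 0 /\ v m = u m * r m) ->
  lim (v @ \oo) = l * lim (u @ \oo).
Proof.
move=> l0 cr vE.
have vE' : \forall m \near \oo, u m * r m = v m.
  by exists 1%N => // m /= m0; case: (vE m m0).
have uE' : \forall m \near \oo, v m * (r m)^-1 = u m.
  by exists 1%N => // m /= m0; case: (vE m m0) => rm ->; rewrite mulfK.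
have [cu|ncu] := pselect (cvg (u @ \oo)).
  apply: (@norm_cvg_lim K K^o); rewrite [l * _]mulrC.
  have h : (fun m => u m * r m) @ \oo --> lim (u @ \oo) * l by exact: cvgM cu cr.
  move: h; apply: cvg_trans; exact: (near_eq_cvg vE').
have ncv : ~ cvg (v @ \oo).
  move=> cv; apply: ncu; apply/cvg_ex; exists (lim (v @ \oo) * l^-1).
  have h : (fun m => v m * (r m)^-1) @ \oo --> lim (v @ \oo) * l^-1.
    exact: cvgM cv (cvgV l0 cr).
  move: h; apply: cvg_trans; exact: (near_eq_cvg uE').
by rewrite (dvgP ncu) (dvgP ncv) [point]/(0 : K) mulr0.
Qed.

(** Euler's quotient at z + 1 is the one at z times z / (1 + (z + 1) / m), and this factor tends to
    z. The hypothesis keeps every denominator nonzero. *)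
Lemma cGammaS z : (forall m : nat, z + m%:R != 0) ->
  cGamma (z + 1) = z * cGamma z.
Proof.
move=> zm; have z0 : z != 0 by have := zm 0%N; rewrite addr0.
have mn m : (0 < m)%N -> (m%:R : R[i]) != 0.
  by move=> m0; rewrite pnatr_eq0 -lt0n.
apply: (@lim_mul_seq R[i] _ _ (fun m : nat => z / (1 + (z + 1) * m%:R^-1))) => //.
  suff : (fun m : nat => z / (1 + (z + 1) * m%:R^-1) : R[i]^o) @ \oo -->
      (z / (1 + (z + 1) * 0) : R[i]^o) by rewrite mulr0 addr0 divr1.
  apply: cvgM; first exact: cvg_cst.
  apply: cvgV; first by rewrite mulr0 addr0 oner_eq0.
  apply: cvgD; first exact: cvg_cst.
  apply: cvgM; [exact: cvg_cst|exact: cvg_invn_complex].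
move=> m m0.
have zm1 : z + 1 + m%:R != 0 by rewrite -addrA nat1r; exact: zm.
have d0 : 1 + (z + 1) / m%:R != 0 :> R[i].
  rewrite (_ : _ + _ = (z + 1 + m%:R) / m%:R); last by field; exact: mn.
  by rewrite mulf_neq0// invr_neq0// mn.
split; first by rewrite mulf_neq0// invr_neq0.
have P0 : \prod_(0 <= k < m) (z + k.+1%:R) != 0.
  by rewrite prodf_seq_neq0; apply/allP => k _; exact: zm.
rewrite mulrDl mul1r cexpD cexp_real lnK ?posrE ?ltr0n//.
(* The two products share the factors z + 1, ..., z + m; the last factor z + 1 + m is split off on
   the left, the first factor z on the right. *)
rewrite [in LHS]big_nat_recr //= [in RHS]big_nat_recl //= addr0.
under eq_bigr do rewrite -addrA nat1r.
rewrite rmorph_nat; field.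
by rewrite z0 P0 mn //= addrC zm1.
Qed.
End Gamma.

(** * Generic points *)

Section Generic.
Local Open Scope classical_set_scope.
Variables (R : realType) (n : nat).
Implicit Types x : nu_space R n.

Definition generic_pair (p q : gtidx n) x : Prop :=
  [/\ complex.Re (x 0 (enum_rank p)) != 0,
     p != q -> complex.Re (x 0 (enum_rank p) - x 0 (enum_rank q)) != 0 &
     p != q -> complex.Re (x 0 (enum_rank p) + x 0 (enum_rank q)) != 0].

Definition generic : set (nu_space R n) :=
  [set x | forall p q, generic_pair p q x].

(** There are finitely many pairs, so the eventual conditions may be intersected. *)
Lemma near_generic (T : Type) (F : set_system T) (g : T -> nu_space R n) :
  Filter F -> (forall p q, \forall t \near F, generic_pair p q (g t)) ->
  \forall t \near F, generic (g t).
Proof.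
move=> FF h.
apply: (@filter_forall _ _ (fun p t => forall q, generic_pair p q (g t)) F) => p.
exact: (@filter_forall _ _ (fun q t => generic_pair p q (g t)) F).
Qed.

Lemma ReD (z w : R[i]) : complex.Re (z + w) = complex.Re z + complex.Re w.
Proof. by case: z; case: w. Qed.
Lemma ReN (z : R[i]) : complex.Re (- z) = - complex.Re z.
Proof. by case: z. Qed.

(** Since |Re| is at most the modulus, the ball of radius |Re z| about z misses the imaginary
    axis. *)
Lemma open_Re_neq0 : open [set z : R[i]^o | complex.Re z != 0].
Proof.
rewrite openE => z /= z0; rewrite /interior /=.
have : nbhs (z : R[i]^o) (ball (z : R[i]^o) (`|complex.Re z|%:C)).
  by apply: nbhsx_ballx; rewrite ltcR normr_gt0.
apply: filterS => y; rewrite /ball /= => h.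
(* The order of [R[i]] is partial: negating a strict inequality needs both sides to be real. *)
apply: contraL h => /eqP y0; rewrite -real_leNgt ?normr_real//; last first.
  by rewrite complex_real.
apply: le_trans (normc_ge_Re _).
by rewrite lecR ReD ReN y0 subr0.
Qed.

Lemma open_generic : open generic.
Proof.
have oN f : continuous (f : nu_space R n -> R[i]^o) ->
    forall x, complex.Re (f x) != 0 -> \forall y \near x, complex.Re (f y) != 0.
  move=> cf x fx; apply: (@open_nbhs_nbhs _ x); split => //.
  by apply: (@open_comp _ _ f) open_Re_neq0 => y _; exact: cf.
have cx i : continuous (fun x : nu_space R n => (x 0 i : R[i]^o)).
  exact: coord_continuous.
rewrite openE => x gx; rewrite /interior.
apply: (@near_generic _ (nbhs x) id) => p q.
have [gp gm gs] := gx p q.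
have hp := oN _ (cx (enum_rank p)) _ gp.
have [<-|pq] := eqVneq p q.
  by apply: filterS hp => y yp; split => // /eqP.
have cB : continuous (fun y : nu_space R n =>
    (y 0 (enum_rank p) - y 0 (enum_rank q) : R[i]^o)).
  by move=> y; exact: (cvgB (cx _ y) (cx _ y)).
have cD : continuous (fun y : nu_space R n =>
    (y 0 (enum_rank p) + y 0 (enum_rank q) : R[i]^o)).
  by move=> y; exact: (cvgD (cx _ y) (cx _ y)).
have hm := oN _ cB _ (gm pq); have hs := oN _ cD _ (gs pq).
by apply: filterS3 hp hm hs => y *.
Qed.

(** The only zero is t = -a/b; for a = 0 this is the excluded point 0, otherwise it lies at distance
    |a/b| from 0. *)
Lemma near0_affine_neq0 (a b : R) : b != 0 ->
  \forall t \near (0 : R^o)^', a + t * b != 0.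
Proof.
move=> b0; have [a0|a0] := eqVneq a 0.
  near=> t; rewrite a0 add0r mulf_neq0//.
  by near: t; exact: nbhs_dnbhs_neq.
have e0 : 0 < `|a / b| by rewrite normr_gt0 mulf_neq0// invr_neq0.
near=> t; have : `|t| < `|a / b| by near: t; exact: dnbhs0_lt.
apply: contraTneq => /eqP; rewrite addrC addr_eq0 => /eqP tb.
by rewrite -leNgt -[X in _ <= `|X|](mulfK b0) tb mulNr normrN.
Unshelve. all: by end_near.
Qed.

(** On the line x + t v with v = (1, 2, 3, ...) each genericity condition is affine in the real
    parameter t, with nonzero slope because the entries of v, their differences and their sums are
    nonzero. So all small t other than 0 give generic points. *)
Lemma dense_generic : dense generic.
Proof.
move=> O [x Ox] oO.
pose v : 'rV[R[i]^o]_#|gtidx n| := \row_i (i.+1%:R : R)%:C.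
pose g (t : R^o) : 'rV[R[i]^o]_#|gtidx n| := x + t%:C *: v.
have g0 : g 0 = x by rewrite /g rmorph0 scale0r addr0.
have cg : g @ (0 : R^o)^' --> (x : 'rV[R[i]^o]_#|gtidx n|).
  have ct : g @ (0 : R^o) --> g 0.
    apply: cvgD; [exact: cvg_cst|apply: cvgZr_tmp].
    exact: real_complex_continuous.
  by rewrite -[in X in _ --> X]g0; move: ct; apply: cvg_trans; apply: cvg_app;
     exact: nbhs_dnbhs.
have hO : \forall t \near (0 : R^o)^', O (g t).
  by apply: cg; exact: open_nbhs_nbhs.
have gE t i : complex.Re (g t 0 i) = complex.Re (x 0 i) + t * i.+1%:R.
  by rewrite /g !mxE ReD; congr (_ + _); case: (x 0 i) => *; rewrite /=; ring.
have hG : \forall t \near (0 : R^o)^', generic (g t).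
  apply: near_generic => p q.
  set i := enum_rank p; set j := enum_rank q.
  have hp : \forall t \near (0 : R^o)^', complex.Re (g t 0 i) != 0.
    near=> t; rewrite gE; near: t; apply: near0_affine_neq0.
    by rewrite pnatr_eq0.
  have [pq|pq] := eqVneq p q.
    by apply: filterS hp => y yp; split => //; rewrite pq => /eqP.
  have hm : \forall t \near (0 : R^o)^', complex.Re (g t 0 i - g t 0 j) != 0.
    near=> t; rewrite ReD ReN !gE opprD addrACA -mulrBr.
    near: t; apply: near0_affine_neq0.
    rewrite subr_eq0 eqr_nat eqSS; apply: contra pq => /eqP ij.
    by apply/eqP/enum_rank_inj/val_inj.
  have hs : \forall t \near (0 : R^o)^', complex.Re (g t 0 i + g t 0 j) != 0.
    near=> t; rewrite ReD !gE addrACA -mulrDr.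
    near: t; apply: near0_affine_neq0.
    by rewrite -natrD pnatr_eq0.
  by apply: filterS3 hp hm hs => y *.
have [t [Ot Gt]] : exists t, (O `&` generic) (g t).
  exact: (@filter_ex _ ((0 : R^o)^') _ _ (filterI hO hG)).
by exists (g t).
Unshelve. all: by end_near.
Qed.
End Generic.

(** * Lagrange interpolation *)

Section Lagrange.
Variable K : fieldType.
Implicit Types (Z t : seq K).

(** The monic polynomial with roots t has degree one less than the number of nodes, hence equals its
    Lagrange interpolant; the identity compares leading coefficients. *)
Lemma lagrange_lead Z t : uniq Z -> size Z = (size t).+1 ->
  \sum_(z <- Z) (\prod_(a <- t) (z - a)) / \prod_(y <- Z | y != z) (z - y) = 1.
Proof.
move=> uZ sZ.
pose q z := \prod_(y <- Z | y != z) ('X - y%:P).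
pose co z := (\prod_(a <- t) (z - a)) / \prod_(y <- Z | y != z) (z - y).
pose p := \prod_(a <- t) ('X - a%:P) - \sum_(z <- Z) co z *: q z.
have hq z u : (q z).[u] = \prod_(y <- Z | y != z) (u - y).
  by rewrite horner_prod; apply: eq_bigr => y _; rewrite !hornerE.
have sq z : z \in Z -> size (q z) = (size t).+1.
  move=> zZ; rewrite /q -big_filter size_prod_XsubC; congr _.+1.
  have := rem_filter z uZ => h.
  have -> : [seq y <- Z | y != z] = rem z Z by rewrite h.
  by rewrite size_rem // sZ.
have p0 : p = 0.
  apply: (@roots_geq_poly_eq0 _ _ Z) => //.
    apply/allP => z zZ; rewrite /root !hornerE horner_prod horner_sum.
    under eq_bigr do rewrite hornerXsubC.
    rewrite [X in _ - X](bigD1_seq z) //= hornerZ hq /co divfK; last first.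
      by rewrite prodf_seq_neq0; apply/allP => y _; rewrite subr_eq0 eq_sym; apply/implyP.
    rewrite [X in _ - (_ + X)]big_seq_cond [X in _ - (_ + X)]big1.
      by rewrite addr0 subrr.
    move=> y /andP[yZ yz].
    rewrite hornerZ hq; apply/eqP; rewrite mulf_eq0 prodf_seq_eq0; apply/orP; right.
    by apply/hasP; exists z => //; rewrite subrr eqxx andbT eq_sym.
  rewrite sZ; apply: leq_trans (size_polyD _ _) _.
  rewrite geq_max size_prod_XsubC leqnn size_polyN.
  rewrite big_seq; apply: (big_ind (fun r : {poly K} => size r <= (size t).+1)%N).
  - by rewrite size_poly0.
  - by move=> u v hu hv; apply: leq_trans (size_polyD _ _) _; rewrite geq_max hu.
  - by move=> z zZ; apply: leq_trans (size_scale_leq _ _) _; rewrite sq.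
have lead (s : seq K) : (\prod_(a <- s) ('X - a%:P))`_(size s) = 1.
  have := monic_prod_XsubC s xpredT id => /monicP.
  by rewrite /lead_coef size_prod_XsubC.
have := congr1 (fun r : {poly K} => r`_(size t)) p0.
rewrite coef0 coefB lead coef_sum => /eqP; rewrite subr_eq0 => /eqP h; rewrite [RHS]h.
apply: eq_big_seq => z zZ.
have := sq z zZ; rewrite /q coefZ -big_filter size_prod_XsubC => -[<-].
by rewrite lead mulr1.
Qed.

(** This is [lagrange_lead] for the nodes z0 :: Z, with the term of z0 moved to the right-hand
    side. *)
Lemma lagrange_pole Z t z0 : uniq (z0 :: Z) -> size Z = size t ->
  \sum_(z <- Z) (\prod_(a <- t) (z - a)) / ((z - z0) * \prod_(y <- Z | y != z) (z - y))
  = 1 - (\prod_(a <- t) (z0 - a)) / \prod_(y <- Z) (z0 - y).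
Proof.
move=> uZ sZ; have := @lagrange_lead (z0 :: Z) t uZ; rewrite /= sZ => /(_ erefl).
move: uZ => /= /andP[z0Z uZ].
rewrite big_cons big_cons eqxx /=.
have -> : \prod_(y <- Z | y != z0) (z0 - y) = \prod_(y <- Z) (z0 - y).
  rewrite -big_filter; congr bigop; apply/all_filterP/allP => y yZ.
  by apply: contraNneq z0Z => <-.
move=> h; rewrite -[X in _ = X - _]h [RHS]addrAC subrr add0r; apply: eq_big_seq => z zZ.
by rewrite big_cons (_ : z0 != z) //; apply: contraNneq z0Z => ->.
Qed.
End Lagrange.

(** * Commutators of shift operators *)

Section Operators.
Variables (K : comNzRingType) (T : Type) (G : T -> Prop) (w : T -> K).

(** [op_comm] over an arbitrary space of points, convertible to it at [nu_space R n]. *)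
Definition comm_op (A B : (T -> K) -> T -> K) (f : T -> K) (x : T) : K :=
  A (B f) x - B (A f) x.

Section CommRight.
Variables (IA IB : eqType) (PA : seq IA) (PB : seq IB).
Variables (P Q : IA -> T -> K) (b : IB -> T -> K).
Variables (ta : IA -> T -> T) (tb : IB -> T -> T).
Variables (t : IA -> T -> K) (v : IB -> T -> K).
Variables (A B : (T -> K) -> T -> K).
Hypothesis AE : forall f y, A f y = \sum_(p <- PA) P p y * Q p y * f (ta p y).
Hypothesis BE : forall f y, B f y = \sum_(r <- PB) b r y * f (tb r y).
Hypothesis Ga : forall p y, G y -> G (ta p y).
Hypothesis Pb : forall p r y, P p (tb r y) = P p y.
Hypothesis tab : forall p r y, ta p (tb r y) = tb r (ta p y).
Hypothesis wa : forall p y, p \in PA -> G y -> w (ta p y) = t p y * w y.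
Hypothesis wb : forall r y, r \in PB -> G y -> w (tb r y) = v r y * w y.

(** Shifts commute, so both orders evaluate w at the same points; P, which the shifts of B leave
    alone, comes out of the difference. *)
Lemma comm_op_right x : G x -> comm_op A B w x =
  (\sum_(p <- PA) t p x * P p x *
     (\sum_(r <- PB) (Q p x * b r (ta p x) - b r x * Q p (tb r x)) * v r (ta p x)))
  * w x.
Proof.
move=> Gx; rewrite /comm_op.
have -> : A (B w) x = \sum_(p <- PA) \sum_(r <- PB)
    t p x * P p x * (Q p x * b r (ta p x) * v r (ta p x)) * w x.
  rewrite AE; apply: eq_big_seq => p pA; rewrite BE mulr_sumr.
  apply: eq_big_seq => r rB; rewrite wb //; last exact: Ga.
  by rewrite wa //; ring.
have -> : B (A w) x = \sum_(p <- PA) \sum_(r <- PB)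
    t p x * P p x * (b r x * Q p (tb r x) * v r (ta p x)) * w x.
  rewrite BE exchange_big /=; apply: eq_big_seq => r rB; rewrite AE mulr_sumr.
  apply: eq_big_seq => p pA; rewrite tab Pb wb //; last exact: Ga.
  by rewrite wa //; ring.
rewrite -sumrB mulr_suml; apply: eq_bigr => p _.
rewrite -sumrB mulr_sumr mulr_suml; apply: eq_bigr => r _; ring.
Qed.

End CommRight.

Variables (IA IB IC : eqType) (PA : seq IA) (PB : seq IB) (PC : seq IC).
Variables (P Q : IA -> T -> K) (b : IB -> T -> K) (c : IC -> T -> K).
Variables (ta : IA -> T -> T) (tb : IB -> T -> T) (tc : IC -> T -> T).
Variables (t : IA -> T -> K) (v : IB -> T -> K) (u : IC -> T -> K).
Variables (A B C : (T -> K) -> T -> K).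
Hypothesis AE : forall f y, A f y = \sum_(p <- PA) P p y * Q p y * f (ta p y).
Hypothesis BE : forall f y, B f y = \sum_(r <- PB) b r y * f (tb r y).
Hypothesis CE : forall f y, C f y = \sum_(q <- PC) c q y * f (tc q y).
Hypothesis Ga : forall p y, G y -> G (ta p y).
Hypothesis Gc : forall q y, G y -> G (tc q y).
Hypothesis Pb : forall p r y, P p (tb r y) = P p y.
Hypothesis Qc : forall p q y, Q p (tc q y) = Q p y.
Hypothesis cb : forall q r y, c q (tb r y) = c q y.
Hypothesis bc : forall q r y, b r (tc q y) = b r y.
Hypothesis vc : forall q r y, v r (tc q y) = v r y.
Hypothesis tab : forall p r y, ta p (tb r y) = tb r (ta p y).
Hypothesis tac : forall p q y, ta p (tc q y) = tc q (ta p y).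
Hypothesis tcb : forall q r y, tc q (tb r y) = tb r (tc q y).
Hypothesis wa : forall p y, p \in PA -> G y -> w (ta p y) = t p y * w y.
Hypothesis wb : forall r y, r \in PB -> G y -> w (tb r y) = v r y * w y.
Hypothesis wc : forall q y, q \in PC -> G y -> w (tc q y) = u q y * w y.

(* C and B commute, so the double commutator factors through each term of A. *)
Lemma comm_op_factor s x : G x ->
  A w x + s * (comm_op C A w x + comm_op A B w x)
    + s ^+ 2 * comm_op (comm_op C A) B w x
  = (\sum_(p <- PA) t p x *
      (P p x + s * \sum_(q <- PC)
         (c q x * P p (tc q x) - P p x * c q (ta p x)) * u q (ta p x)) *
      (Q p x + s * \sum_(r <- PB)
         (Q p x * b r (ta p x) - b r x * Q p (tb r x)) * v r (ta p x))) * w x.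
Proof.
move=> Gx.
(* [C, A] has again the form of A: its shifts are indexed by pairs (p, q), with P' in place of P and
   the same Q. Hence [comm_op_right] also gives [[C, A], B]. *)
pose P' (pq : IA * IC) y :=
  c pq.2 y * P pq.1 (tc pq.2 y) - P pq.1 y * c pq.2 (ta pq.1 y).
pose tca (pq : IA * IC) y := tc pq.2 (ta pq.1 y).
have CAE f y : comm_op C A f y =
    \sum_(pq <- [seq (p, q) | p <- PA, q <- PC]) P' pq y * Q pq.1 y * f (tca pq y).
  rewrite big_allpairs_dep /comm_op CE AE.
  under [X in X - _]eq_bigr do rewrite AE mulr_sumr.
  rewrite exchange_big -sumrB; apply: eq_bigr => p _.
  rewrite CE mulr_sumr -sumrB; apply: eq_bigr => q _ /=.
  by rewrite Qc /tca tac /P' /=; ring.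
have mpq p q : (p, q) \in [seq (p, q) | p <- PA, q <- PC] -> p \in PA /\ q \in PC.
  by case/allpairsP => -[p' q'] /= [? ? [-> ->]].
have wca pq y : pq \in [seq (p, q) | p <- PA, q <- PC] -> G y ->
    w (tca pq y) = (u pq.2 (ta pq.1 y) * t pq.1 y) * w y.
  by case: pq => p q /mpq[pA qC] Gy; rewrite /tca /= wc ?wa ?mulrA//; exact: Ga.
rewrite (comm_op_right AE BE Ga Pb tab wa wb Gx).
rewrite (comm_op_right CAE BE _ _ _ wca wb Gx); last first.
- by move=> -[p q] r y; rewrite /tca /= tab tcb.
- by move=> -[p q] r y; rewrite /P' /= cb tcb Pb tab cb Pb.
- by move=> -[p q] y Gy; exact/Gc/Ga.
rewrite CAE AE !big_allpairs_dep /=.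
have -> : \sum_(p <- PA) P p x * Q p x * w (ta p x) =
    (\sum_(p <- PA) t p x * P p x * Q p x) * w x.
  by rewrite mulr_suml; apply: eq_big_seq => p pA; rewrite wa //; ring.
have -> : \sum_(p <- PA) \sum_(q <- PC) P' (p, q) x * Q p x * w (tca (p, q) x) =
    (\sum_(p <- PA) t p x * Q p x * (\sum_(q <- PC) P' (p, q) x * u q (ta p x))) * w x.
  rewrite mulr_suml; apply: eq_big_seq => p pA.
  rewrite mulr_sumr mulr_suml; apply: eq_big_seq => q qC.
  by rewrite wca /=; [ring|apply/allpairsP; exists (p, q)|].
pose X p := \sum_(q <- PC) P' (p, q) x * u q (ta p x).
pose Y p := \sum_(r <- PB) (Q p x * b r (ta p x) - b r x * Q p (tb r x)) * v r (ta p x).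
rewrite [X in _ + s ^+ 2 * X](_ : _ = (\sum_(p <- PA) t p x * X p * Y p) * w x).
  rewrite mulrDr !mulrA -!mulrDl; congr (_ * w x).
  rewrite !mulr_sumr -!big_split /=; apply: eq_bigr => p _.
  by rewrite -/(X p) -/(Y p); ring.
congr (_ * w x); apply: eq_bigr => p _.
rewrite -mulrA mulr_suml mulr_sumr; apply: eq_bigr => q _.
(* Neither [b] nor [v] sees the shifts of C, so the sum over r is the same for all q, and X and Y
   separate. *)
rewrite [X in _ * X = _](_ : _ = Y p); first by ring.
by apply: eq_bigr => r _; rewrite /tca /= bc vc.
Qed.

End Operators.

(** * The coefficients of a layer *)

Section AddAt.
Variable K : comNzRingType.
Implicit Types (f : nat -> K) (d : K).

Definition add_at f j d : nat -> K := fun r => f r + (if r == j then d else 0).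

Lemma add_at_eq f j d : add_at f j d j = f j + d.
Proof. by rewrite /add_at eqxx. Qed.

Lemma add_at_neq f j d r : r != j -> add_at f j d r = f r.
Proof. by rewrite /add_at => /negPf ->; rewrite addr0. Qed.

Lemma prod_natD1 (a b j : nat) (F : nat -> K) : (a <= j < b)%N ->
  \prod_(a <= r < b) F r = F j * \prod_(a <= r < b | r != j) F r.
Proof.
by move=> jab; rewrite (bigD1_seq j) //= ?mem_index_iota // iota_uniq.
Qed.

Lemma prod_add_at (a b j : nat) (F : K -> K) f d : (a <= j < b)%N ->
  \prod_(a <= r < b) F (add_at f j d r) =
  F (f j + d) * \prod_(a <= r < b | r != j) F (f r).
Proof.
move=> jab; rewrite (prod_natD1 _ jab) add_at_eq; congr (_ * _).
by apply: eq_bigr => r rj; rewrite add_at_neq.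
Qed.
End AddAt.

Section Layer.
Variables (R : realType) (c : R).
Hypothesis c0 : 0 < c.
Local Notation K := R[i].
Local Notation h := (ic c).
Implicit Types (kap rho mu nu lam : nat -> K) (e : bool).

(* kap, rho, mu, nu, lam stand for nu_{2k-3}, nu_{2k-2}, nu_{2k-1}, nu_{2k},
   nu_{2k+1}, and a boolean e for the sign (-1)^e. *)

(** Equivalently, z + w and z - w both have nonzero real part. *)
Definition sep (z w : K) := complex.Re z ^+ 2 != complex.Re w ^+ 2.

Lemma Re_h : complex.Re h = 0.
Proof. by rewrite /ic /=; ring. Qed.

Lemma Re_h2 : complex.Re (h / 2) = 0.
Proof. by rewrite /ic /=; ring. Qed.

Lemma h_neq0 : h != 0.
Proof.
by rewrite /ic mulf_neq0 // ?eq_complex /= ?oner_eq0 ?andbF // eqxx andbT gt_eqF.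
Qed.

Lemma Re_sign e (z : K) : complex.Re ((-1) ^+ e * z) = (-1) ^+ e * complex.Re z.
Proof. by case: e; rewrite ?expr0 ?expr1 ?mulN1r ?mul1r ?ReN. Qed.

(** The denominators below have the form +-z +- w plus a multiple of h/2. As h is imaginary, their
    real part is up to sign the sum or the difference of Re z and Re w; squaring removes the
    sign. *)
Lemma sep_neq (z w E : K) : sep z w -> 
   complex.Re E ^+ 2 = (complex.Re z + complex.Re w) ^+ 2 \/
   complex.Re E ^+ 2 = (complex.Re z - complex.Re w) ^+ 2 -> E != 0.
Proof.
move=> zw [] H; apply: contraNneq zw => E0; move: H; rewrite E0 expr0n /= => /esym/eqP;
  rewrite sqrf_eq0 => /eqP H; by rewrite -subr_eq0 subr_sqr H ?mulr0 ?mul0r.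
Qed.


(* [None] indexes the node -h/2, i.e. the summand of I_{2k+2,2k+1} that does
   not shift. *)
Definition node nu (q : option (bool * nat)) : K :=
  if q is Some (b, l) then (-1) ^+ b * nu l else - (h / 2).

Definition node_idx k : seq (option (bool * nat)) :=
  None :: [seq Some (false, l) | l <- index_iota 1 k.+1]
       ++ [seq Some (true, l) | l <- index_iota 1 k.+1].

Definition nodes k nu : seq K := [seq node nu q | q <- node_idx k].

Lemma node_idxP k q : q \in node_idx k ->
  q = None \/ exists b l, (1 <= l < k.+1)%N /\ q = Some (b, l).
Proof.
rewrite inE => /orP[/eqP ->|]; first by left.
by rewrite mem_cat => /orP[] /mapP[l]; rewrite mem_index_iota => lk ->; right;
  [exists false|exists true]; exists l.
Qed.

Lemma size_nodes k nu : size (nodes k nu) = (2 * k).+1.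
Proof. by rewrite size_map /= size_cat !size_map size_iota subn1 mul2n -addnn. Qed.

Definition gen_layer k nu :=
  forall l, (1 <= l < k.+1)%N -> complex.Re (nu l) != 0 /\
    forall r, (1 <= r < k.+1)%N -> r != l -> sep (nu l) (nu r).

Definition sep_layers k nu k' mu :=
  forall l, (1 <= l < k.+1)%N -> forall r, (1 <= r < k'.+1)%N -> sep (nu l) (mu r).

(** Real parts suffice: they are 0 for the node -h/2 and +-Re nu_l for the others, which are nonzero
    and pairwise distinct. *)
Lemma node_inj k nu : gen_layer k nu -> {in node_idx k &, injective (node nu)}.
Proof.
move=> g q q' /node_idxP qk /node_idxP qk' /(congr1 (@complex.Re R)).
have h2 : complex.Re (- (h / 2)) = 0 by rewrite ReN Re_h2 oppr0.
have sq (b : bool) (x : R) : ((-1) ^+ b * x) ^+ 2 = x ^+ 2.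
  by rewrite exprMn sqrr_sign mul1r.
have n0 (b : bool) l : (1 <= l < k.+1)%N -> complex.Re (node nu (Some (b, l))) != 0.
  by move=> /g[nl _]; rewrite /node Re_sign mulf_neq0 // signr_eq0.
case: qk => [->|[b [l [lk ->]]]]; case: qk' => [->|[b' [l' [lk' ->]]]] //.
- by rewrite h2 => /esym/eqP; rewrite (negPf (n0 _ _ _)).
- by rewrite h2 => /eqP; rewrite (negPf (n0 _ _ _)).
rewrite /node !Re_sign; have [ll|ll] := eqVneq l' l.
  by move: (g _ lk) => [nl _]; rewrite ll => /(mulIf nl)/signr_inj ->.
move=> /(congr1 (fun x => x ^+ 2)); rewrite !sq => /eqP.
by rewrite (negPf ((g _ lk).2 _ lk' ll)).
Qed.

Lemma uniq_nodes k nu : gen_layer k nu -> uniq (nodes k nu).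
Proof.
move=> g; rewrite map_inj_in_uniq; last exact: (node_inj g).
rewrite /= mem_cat negb_or cat_uniq; apply/and3P; split.
- by apply/andP; split; apply/mapP => -[].
- by rewrite map_inj_uniq ?iota_uniq // => x y [].
- rewrite map_inj_uniq ?iota_uniq ?andbT // => [|x y []//].
  by apply/hasPn => x /mapP[l _ ->]; apply/mapP => -[].
Qed.

Lemma prod_nodes k nu z :
  \prod_(y <- nodes k nu) (z - y) =
  (z + h / 2) * \prod_(1 <= r < k.+1) (z ^+ 2 - nu r ^+ 2).
Proof.
rewrite big_map big_cons big_cat !big_map /= opprK -big_split /=.
congr (_ * _); apply: eq_bigr => r _; by rewrite expr0 expr1; ring.
Qed.

Lemma prod_nodes_neq k nu q : gen_layer k nu -> q \in node_idx k ->
  \prod_(y <- nodes k nu | y != node nu q) (node nu q - y) =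
  \prod_(q' <- node_idx k | q' != q) (node nu q - node nu q').
Proof.
move=> g qk; rewrite big_map big_seq_cond [RHS]big_seq_cond; apply: eq_bigl => q'.
apply: andb_id2l => qk'; congr (~~ _); apply/eqP/eqP => [|-> //].
exact: (node_inj g).
Qed.

Lemma prod_nodes_None k nu : gen_layer k nu ->
  \prod_(y <- nodes k nu | y != - (h / 2)) (- (h / 2) - y) =
  \prod_(1 <= r < k.+1) ((h / 2) ^+ 2 - nu r ^+ 2).
Proof.
move=> g; rewrite (@prod_nodes_neq _ _ None) // ?inE //.
rewrite big_cons eqxx big_cat !big_map /= -big_split /=; apply: eq_bigr => r _.
by rewrite expr0 expr1; ring.
Qed.

(** The opposite node contributes 2z, the node -h/2 contributes z + h/2, and each pair +-nu_r
    contributes nu_l^2 - nu_r^2. The result is the denominator of the shift coefficient of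
    I_{2k+2,2k+1}. *)
Lemma prod_nodes_Some k nu (b : bool) l : gen_layer k nu -> (1 <= l < k.+1)%N ->
  let z := (-1) ^+ b * nu l in
  \prod_(y <- nodes k nu | y != z) (z - y) =
  2 * z * (z + h / 2) * \prod_(1 <= r < k.+1 | r != l) (nu l ^+ 2 - nu r ^+ 2).
Proof.
move=> g lk z; rewrite (@prod_nodes_neq _ _ (Some (b, l))) //; last first.
  by rewrite inE /= mem_cat; apply/orP; case: b @z => z; [right|left];
   apply/mapP; exists l; rewrite ?mem_index_iota.
rewrite big_cons big_cat !big_map /= opprK -/z.
have -> : \prod_(1 <= r < k.+1 | r != l) (nu l ^+ 2 - nu r ^+ 2) =
  \prod_(1 <= r < k.+1 | r != l) (z - nu r) * \prod_(1 <= r < k.+1 | r != l) (z + nu r).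
  rewrite -big_split /=; apply: eq_bigr => r _.
  by rewrite -subr_sqr /z exprMn sqrr_sign mul1r.
case: b @z => z; rewrite /=.
  rewrite [X in _ * (X * _)](eq_bigr (fun r => z - nu r)) => [|r _];
    last by rewrite expr0 mul1r.
  rewrite [X in _ * (_ * X)](eq_bigr (fun r => z + nu r)) => [|r _];
    last by rewrite expr1; ring.
  rewrite [X in _ * (X * _)](_ : _ = \prod_(1 <= r < k.+1) (z - nu r)); last exact: eq_bigl.
  rewrite (prod_natD1 (fun r => z - nu r) lk) /z expr1.
  by rewrite (eq_bigl (fun r => r != l)) //; ring.
rewrite [X in _ * (X * _)](eq_bigr (fun r => z - nu r)) => [|r _];
    last by rewrite expr0 mul1r.
rewrite [X in _ * (_ * X)](eq_bigr (fun r => z + nu r)) => [|r _];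
    last by rewrite expr1; ring.
rewrite [X in _ * (_ * X)](_ : _ = \prod_(1 <= r < k.+1) (z + nu r)); last exact: eq_bigl.
rewrite (prod_natD1 (fun r => z + nu r) lk) /z expr0.
by rewrite (eq_bigl (fun r => r != l)) //; ring.
Qed.

End Layer.

(** * The action of I_{2k+2,2k+1} as Lagrange weights *)

Section Weights.
Variables (R : realType) (c : R).
Hypothesis c0 : 0 < c.
Local Notation K := R[i].
Local Notation h := (ic c).
Implicit Types (kap rho mu nu lam : nat -> K) (e : bool).

(** With z = (-1)^b nu_l both shifts share one formula: for b = true, nu_l - h/2 is -(z + h/2), and
    the signs cancel in the squares and in the denominator. *)
Definition ccoef k mu nu lam (q : option (bool * nat)) : K :=
  if q is Some (b, l) then
    let z := (-1) ^+ b * nu l in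
    h^-1 * ((if b then \prod_(1 <= r < k.+1) ((z + h / 2) ^+ 2 - mu r ^+ 2)
             else \prod_(1 <= r < k.+2) ((z + h / 2) ^+ 2 - lam r ^+ 2))
            / (2 * z * (z + h / 2)
               * \prod_(1 <= r < k.+1 | r != l) (nu l ^+ 2 - nu r ^+ 2)))
  else (c^-1)%:C * ((\prod_(1 <= r < k.+1) mu r * \prod_(1 <= r < k.+2) lam r)
         / \prod_(1 <= r < k.+1) (nu r ^+ 2 + (c ^+ 2 / 4)%:C)).

(* The factor by which the Whittaker function changes under the shift q. *)
Definition cratio k e mu nu lam (q : option (bool * nat)) : K :=
  if q is Some (b, l) then
    let z := (-1) ^+ b * nu l in
    - ((-1) ^+ b * (-1) ^+ e * 'i)
    * (if b then \prod_(1 <= r < k.+2) (z + (-1) ^+ e * lam r + h / 2)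
                 / \prod_(1 <= r < k.+1) ((-1) ^+ e * mu r - z - h / 2)
       else \prod_(1 <= r < k.+1) (z + (-1) ^+ e * mu r + h / 2)
            / \prod_(1 <= r < k.+2) ((-1) ^+ e * lam r - z - h / 2))
  else 1.

(** Monic of degree 2k+1 in z: one degree too many for [lagrange_lead] at the 2k+1 nodes, the right
    one for [lagrange_pole]. *)
Definition cnum k e mu lam z : K :=
  \prod_(1 <= r < k.+2) (z + (-1) ^+ e * lam r + h / 2)
  * \prod_(1 <= r < k.+1) (z + (-1) ^+ e * mu r + h / 2).

Lemma prodN_nat m (F : nat -> K) :
  \prod_(1 <= r < m.+1) (- F r) = (-1) ^+ m * \prod_(1 <= r < m.+1) F r.
Proof.
under eq_bigr do rewrite -mulN1r.
by rewrite big_split prodr_const_nat subn1.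
Qed.

(** The denominator is, up to sign, one of the two linear factors of each difference of squares. *)
Lemma prod_ratio m e (x : nat -> K) z :
    (forall r, (1 <= r < m.+1)%N -> (-1) ^+ e * x r - z - h / 2 != 0) ->
  \prod_(1 <= r < m.+1) ((z + h / 2) ^+ 2 - x r ^+ 2)
    / \prod_(1 <= r < m.+1) ((-1) ^+ e * x r - z - h / 2)
  = (-1) ^+ m * \prod_(1 <= r < m.+1) (z + (-1) ^+ e * x r + h / 2).
Proof.
move=> H; rewrite -prodN_nat -prodf_div; apply: eq_big_nat => r rm.
have -> : x r ^+ 2 = ((-1) ^+ e * x r) ^+ 2 by rewrite exprMn sqrr_sign mul1r.
rewrite (_ : _ - _ = ((-1) ^+ e * x r - z - h / 2) * - (z + (-1) ^+ e * x r + h / 2)).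
  by rewrite mulrAC divff ?mul1r //; exact: H.
by ring.
Qed.

Lemma mulii : 'i * 'i = -1 :> K.
Proof. by rewrite -expr2 sqr_i. Qed.

(* I_{2k+2,2k+1} acts on the Whittaker function as a Lagrange sum. *)
Lemma weightE k e (s : bool) mu nu lam q : gen_layer k nu ->
    sep_layers k nu k mu -> sep_layers k nu k.+1 lam -> q \in node_idx k ->
    (-1) ^+ k = - ((-1) ^+ s * (-1) ^+ e) :> K ->
  let z := node c nu q in
  (-1) ^+ s * 'i * (ccoef k mu nu lam q * cratio k e mu nu lam q)
  = h^-1 * (cnum k e mu lam z / \prod_(y <- nodes c k nu | y != z) (z - y)).
Proof.
move=> g gm gl /node_idxP qk sk.
have ssg (b : bool) : (-1) ^+ b * (-1) ^+ b = 1 :> K by rewrite -expr2 sqrr_sign.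
case: qk => [->|[b [l [lk ->]]]] z.
  rewrite /cratio mulr1 /z /node prod_nodes_None // /ccoef /cnum.
  (* Since h^2 = -c^2, each factor nu_r^2 + c^2/4 is -((h/2)^2 - nu_r^2); hence the sign (-1)^k. *)
  rewrite [X in (c^-1)%:C * (_ / X)](_ : _ =
      (-1) ^+ k * \prod_(1 <= r < k.+1) ((h / 2) ^+ 2 - nu r ^+ 2)); last first.
    rewrite -prodN_nat; apply: eq_bigr => r _; rewrite /ic.
    rewrite rmorphM rmorphXn fmorphV rmorph_nat.
    transitivity (- ('i * 'i * c%:C ^+ 2 / 4 - nu r ^+ 2)); last by field.
    by rewrite mulii; field.
  (* At z = -h/2 the half shifts cancel, and the numerator is up to sign the product of all mu_r and
     lam_r. *)
  have sm (f : nat -> K) m : \prod_(1 <= r < m.+1) (- (h / 2) + (-1) ^+ e * f r + h / 2) =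
     ((-1) ^+ e) ^+ m * \prod_(1 <= r < m.+1) f r.
    rewrite -{2}[m](subn1 m.+1) -(prodr_const_nat 1 m.+1).
    by rewrite -big_split /=; apply: eq_bigr => r _; ring.
  rewrite !sm sk invfM.
  have -> : (- ((-1) ^+ s * (-1) ^+ e))^-1 = - ((-1) ^+ s * (-1) ^+ e) :> K.
    by rewrite -signr_addb invrN -exprVn invrN1.
  have -> : (c^-1)%:C = 'i * h^-1.
    rewrite fmorphV /ic invfM mulrA divff ?mul1r //.
    by rewrite eq_complex /= oner_eq0 andbF.
  set L := \prod_(_ <= _ < _) _; set M := \prod_(_ <= _ < _) _.
  set Y := (\prod_(_ <= _ < _) _)^-1.
  have ee : ((-1) ^+ e) ^+ k * ((-1) ^+ e) ^+ k = 1 :> K.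
    by rewrite -exprMn ssg expr1n.
  transitivity (- ('i * 'i) * ((-1) ^+ s * (-1) ^+ s) * (-1) ^+ e * (h^-1 * (L * M) * Y)).
    by ring.
  rewrite mulii ssg exprS.
  transitivity (((-1) ^+ e) ^+ k * ((-1) ^+ e) ^+ k * (-1) ^+ e * (h^-1 * (L * M) * Y)).
    by rewrite ee; ring.
  by ring.
have zE : z = (-1) ^+ b * nu l by [].
rewrite zE prod_nodes_Some // -zE /cratio /ccoef /cnum -zE.
have nz (f : nat -> K) m r : sep_layers k nu m f -> (1 <= r < m.+1)%N ->
    (-1) ^+ e * f r - z - h / 2 != 0.
  move=> sf rm; apply: (@sep_neq _ (nu l) (f r)); first exact: sf.
  rewrite !ReD !ReN Re_h2 subr0 zE !Re_sign.
  by case: (e); case: (b); rewrite ?expr0 ?expr1; [right|left|left|right]; ring.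
have rl := prod_ratio (fun r => nz lam k.+1 r gl).
have rm := prod_ratio (fun r => nz mu k r gm).
have ii : (-1) ^+ s * 'i * (- ((-1) ^+ s * (-1) ^+ e * (-1) ^+ e * 'i)) = 1 :> K.
  transitivity (- ('i * 'i) * ((-1) ^+ s * (-1) ^+ s) * ((-1) ^+ e * (-1) ^+ e) : K).
    by ring.
  by rewrite mulii !ssg; ring.
have sk1 : - (-1) ^+ k = (-1) ^+ s * (-1) ^+ e :> K by rewrite sk opprK.
move: rl rm ii sk1; move: (2 * z * (z + h / 2) * _ : K) => D.
(* The squares in [ccoef] and the denominators in [cratio] belong to the same layer, mu for b = true
   and lam for b = false; [rm] and [rl] cancel them. The additional factor in lam makes up for the
   opposite sign of [cratio]. *)
case: b {zE nz} @z => z; rewrite ?expr0 ?expr1 => rl rm ii sk1.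
  transitivity ((-1) ^+ s * 'i * ((-1) ^+ e * 'i) * h^-1 *
    ((\prod_(1 <= r < k.+1) ((z + h / 2) ^+ 2 - mu r ^+ 2)) /
     (\prod_(1 <= r < k.+1) ((-1) ^+ e * mu r - z - h / 2))) *
    (\prod_(1 <= r < k.+2) (z + (-1) ^+ e * lam r + h / 2)) * D^-1); first by ring.
  rewrite rm -[RHS]mul1r -[X in _ = X * _]ii -sk1; ring.
transitivity ((-1) ^+ s * 'i * (- ((-1) ^+ e * 'i)) * h^-1 *
    ((\prod_(1 <= r < k.+2) ((z + h / 2) ^+ 2 - lam r ^+ 2)) /
     (\prod_(1 <= r < k.+2) ((-1) ^+ e * lam r - z - h / 2))) *
    (\prod_(1 <= r < k.+1) (z + (-1) ^+ e * mu r + h / 2)) * D^-1); first by ring.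
rewrite rl -[RHS]mul1r -[X in _ = X * _]ii -sk1 exprS; ring.
Qed.


End Weights.

(** * The terms of I_{2k+1,2k} and their exchange with adjacent generators *)

Section Terms.
Variables (R : realType) (c : R).
Hypothesis c0 : 0 < c.
Local Notation K := R[i].
Local Notation h := (ic c).
Implicit Types (kap rho mu nu lam : nat -> K) (e : bool) (p : bool * nat).

Definition sgn_at mu p : K := (-1) ^+ p.1 * mu p.2.

(* The coefficient of the shift of mu_j by (-1)^b h in I_{2k+1,2k}, p = (b, j),
   is Pcoef * Qcoef: Pcoef involves only mu and nu, Qcoef only mu and rho. *)
Definition Pcoef k mu nu p : K :=
  - ((-1) ^+ p.1 / h) *
  (\prod_(1 <= r < k.+1) (sgn_at mu p - nu r + h / 2) /
   (2 * \prod_(1 <= r < k.+1 | r != p.2)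
      ((sgn_at mu p - (-1) ^+ p.1 * mu r) * (sgn_at mu p + (-1) ^+ p.1 * mu r + h)))).

Definition Qcoef m rho mu p : K :=
  \prod_(1 <= r < m.+1) (sgn_at mu p + rho r + h / 2).

Definition shift_node nu (q : option (bool * nat)) :=
  if q is Some (b, l) then add_at nu l ((-1) ^+ b * h) else nu.

Definition shift_at mu p := add_at mu p.2 ((-1) ^+ p.1 * h).

Lemma sgnM (b : bool) : (-1) ^+ b * (-1) ^+ b = 1 :> K.
Proof. by rewrite -expr2 sqrr_sign. Qed.

Lemma Re_shift_at mu p r : complex.Re (shift_at mu p r) = complex.Re (mu r).
Proof.
rewrite /shift_at /add_at ReD; case: eqP => _; last by rewrite addr0.
by rewrite Re_sign Re_h mulr0 addr0.
Qed.

Lemma sep_shift_at k nu k' mu p :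
  sep_layers k nu k' mu -> sep_layers k nu k' (shift_at mu p).
Proof. by move=> s l lk r rk; rewrite /sep Re_shift_at; exact: s. Qed.

Lemma ic_halves : h = h / 2 + h / 2.
Proof. by field. Qed.

Ltac ring_half := move: ic_halves; move: (ic c / 2) => hf; move: (ic c) => hh ->; ring.

(** Each shift alters at most one factor. Let z be the node and z0 = h/2 + [sgn_at mu p]: as z + h/2
    - [sgn_at mu p] = (z - z0) + h, the two products in the commutator differ by the factor 1 + h /
    (z - z0), which creates a pole at z0. *)
Lemma ccoef_Pcoef k mu nu lam q p : q \in node_idx k -> (1 <= p.2 < k.+1)%N ->
  ccoef c k mu nu lam q * Pcoef k mu (shift_node nu q) p
    * (node c nu q - (h / 2 + sgn_at mu p)) =
  ccoef c k (shift_at mu p) nu lam q * Pcoef k mu nu p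
    * (node c nu q + h / 2 - sgn_at mu p).
Proof.
case: p => b j /= + jk; rewrite /Pcoef /=; set D := (2 * _)^-1; set M := sgn_at _ _.
have ME : M = (-1) ^+ b * mu j by [].
have mE : mu j = (-1) ^+ b * M by rewrite ME mulrA sgnM mul1r.
move=> /node_idxP[->|[b' [l [lk ->]]]]; rewrite /ccoef /shift_node /node.
  rewrite (prod_natD1 mu jk) (prod_add_at id mu _ jk) /= mE.
  by move: D => D; case: b {ME mE} @M => M; rewrite ?expr0 ?expr1; ring_half.
rewrite (prod_add_at (fun x => M - x + h / 2) nu _ lk).
rewrite (prod_natD1 (fun r => M - nu r + h / 2) lk).
case: b'; rewrite ?expr0 ?expr1.
  rewrite (prod_add_at (fun x => (-1 * nu l + h / 2) ^+ 2 - x ^+ 2) mu _ jk).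
  rewrite (prod_natD1 (fun r => (-1 * nu l + h / 2) ^+ 2 - mu r ^+ 2) jk) /= mE.
  set E := (2 * _ * _ * _)^-1; move: D E => D E.
  by case: b {ME mE} @M => M; rewrite ?expr0 ?expr1; ring_half.
set E := (2 * _ * _ * _)^-1; move: D E => D E; ring_half.
Qed.

(** The same for the layer below, where mu takes the place of lam in [ccoef]. *)
Lemma ccoef_Qcoef m kap rho mu q p : q \in node_idx m -> (1 <= p.2 < m.+2)%N ->
  ccoef c m kap rho mu q * Qcoef m (shift_node rho q) mu p
    * (node c rho q - (h / 2 + sgn_at mu p)) =
  ccoef c m kap rho (shift_at mu p) q * Qcoef m rho mu p
    * (node c rho q + h / 2 - sgn_at mu p).
Proof.
case: p => b j /= + jk; rewrite /Qcoef /=; set M := sgn_at _ _.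
have ME : M = (-1) ^+ b * mu j by [].
have mE : mu j = (-1) ^+ b * M by rewrite ME mulrA sgnM mul1r.
move=> /node_idxP[->|[b' [l [lk ->]]]]; rewrite /ccoef /shift_node /node.
  rewrite (prod_natD1 mu jk) (prod_add_at id mu _ jk) /= mE.
  by case: b {ME mE} @M => M; rewrite ?expr0 ?expr1; ring_half.
rewrite (prod_add_at (fun x => M + x + h / 2) rho _ lk).
rewrite (prod_natD1 (fun r => M + rho r + h / 2) lk).
case: b'; rewrite ?expr0 ?expr1.
  set E := (2 * _ * _ * _)^-1; move: E => E; ring_half.
rewrite (prod_add_at (fun x => (1 * rho l + h / 2) ^+ 2 - x ^+ 2) mu _ jk).
rewrite (prod_natD1 (fun r => (1 * rho l + h / 2) ^+ 2 - mu r ^+ 2) jk) /= mE.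
set E := (2 * _ * _ * _)^-1; move: E => E.
by case: b {ME mE} @M => M; rewrite ?expr0 ?expr1; ring_half.
Qed.

Lemma node_neq k nu mu p q : q \in node_idx k -> complex.Re (mu p.2) != 0 ->
    (forall l, (1 <= l < k.+1)%N -> sep (nu l) (mu p.2)) ->
  node c nu q - (h / 2 + sgn_at mu p) != 0.
Proof.
move=> /node_idxP qk m0 nm.
case: qk => [->|[b' [l [lk ->]]]].
  apply: contraNneq m0 => /(congr1 (@complex.Re R)).
  rewrite /node /sgn_at opprD !(ReD, ReN) Re_h2 Re_sign /= oppr0 !add0r => /eqP.
  by rewrite oppr_eq0 mulf_eq0 signr_eq0.
apply: (@sep_neq _ (nu l) (mu p.2)); first exact: nm.
rewrite /node /sgn_at opprD !(ReD, ReN) Re_h2 !Re_sign oppr0 add0r.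
by case: (b'); case: (p.1); rewrite ?expr0 ?expr1; [right|left|left|right]; ring.
Qed.

End Terms.

(** * Evaluation of the factors X and Y *)

Section Sums.
Variables (R : realType) (c : R).
Hypothesis c0 : 0 < c.
Local Notation K := R[i].
Local Notation h := (ic c).
Implicit Types (kap rho mu nu lam : nat -> K) (e : bool) (p : bool * nat).

(* The factors X and Y of the term p; the sign e belongs to the layer k = m + 1
   of the Whittaker function, hence ~~ e to the layer m. *)
Definition Xfac k (s e : bool) mu nu lam p : K :=
  Pcoef c k mu nu p + (-1) ^+ s * 'i * \sum_(q <- node_idx k)
    (ccoef c k mu nu lam q * Pcoef c k mu (shift_node c nu q) p
     - Pcoef c k mu nu p * ccoef c k (shift_at c mu p) nu lam q)
    * cratio c k e (shift_at c mu p) nu lam q.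

Definition Yfac m (s e : bool) kap rho mu p : K :=
  Qcoef c m rho mu p + (-1) ^+ s * 'i * \sum_(q <- node_idx m)
    (Qcoef c m rho mu p * ccoef c m kap rho (shift_at c mu p) q
     - ccoef c m kap rho mu q * Qcoef c m (shift_node c rho q) mu p)
    * cratio c m (~~ e) kap rho (shift_at c mu p) q.

(** [ccoef_Pcoef] turns each difference of products into h / (z - z0) times one of them, and
    [weightE], taken after the shift of mu, turns this into a Lagrange weight. *)
Lemma XfacE k (s e : bool) mu nu lam p : gen_layer k nu ->
    sep_layers k nu k mu -> sep_layers k nu k.+1 lam ->
    (1 <= p.2 < k.+1)%N -> complex.Re (mu p.2) != 0 ->
    (-1) ^+ k = - ((-1) ^+ s * (-1) ^+ e) :> K ->
  Xfac k s e mu nu lam p = Pcoef c k mu nu p * (1 +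
    \sum_(z <- nodes c k nu) cnum c k e (shift_at c mu p) lam z /
       ((z - (h / 2 + sgn_at mu p)) * \prod_(y <- nodes c k nu | y != z) (z - y))).
Proof.
move=> g gm gl jk m0 sk; rewrite /Xfac mulrDr mulr1; congr (_ + _).
rewrite big_map !mulr_sumr; apply: eq_big_seq => q qk.
have nz : node c nu q - (h / 2 + sgn_at mu p) != 0.
  by apply: (node_neq c qk) => // l lk; exact: gm.
have W := weightE c g (sep_shift_at c p gm) gl qk sk.
have D := @ccoef_Pcoef R c k mu nu lam q p qk jk.
rewrite invfM [X in _ = _ * X]mulrA.
set z := node c nu q in nz W D *; set z0 := h / 2 + _ in nz D *.
rewrite [RHS](_ : _ = Pcoef c k mu nu p * (z - z0)^-1 * h *
   (h^-1 * (cnum c k e (shift_at c mu p) lam z / \prod_(y <- nodes c k nu | y != z) (z - y)))).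
  rewrite -W; set cc := ccoef c k (shift_at c mu p) nu lam q in D *.
  have -> : ccoef c k mu nu lam q * Pcoef c k mu (shift_node c nu q) p =
     cc * Pcoef c k mu nu p * (z + h / 2 - sgn_at mu p) / (z - z0).
    by rewrite -D mulfK.
  rewrite (_ : z + h / 2 - sgn_at mu p = z - z0 + h); last first.
    by rewrite {2}(ic_halves c) /z0; ring.
  by field.
set I := (\prod_(_ <- _ | _) _)^-1; move: I => I.
by field; rewrite (h_neq0 c0) nz.
Qed.

(** As for [XfacE]; the commutator is taken in the other order, whence the minus sign, and the layer
    m carries the sign [~~ e]. *)
Lemma YfacE m (s e : bool) kap rho mu p : gen_layer m rho ->
    sep_layers m rho m kap -> sep_layers m rho m.+1 mu ->
    (1 <= p.2 < m.+2)%N -> complex.Re (mu p.2) != 0 ->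
    (-1) ^+ m = (-1) ^+ s * (-1) ^+ e :> K ->
  Yfac m s e kap rho mu p = Qcoef c m rho mu p * (1 -
    \sum_(z <- nodes c m rho) cnum c m (~~ e) kap (shift_at c mu p) z /
       ((z - (h / 2 + sgn_at mu p)) * \prod_(y <- nodes c m rho | y != z) (z - y))).
Proof.
move=> g gk gm jk m0 sk; rewrite /Yfac mulrBr mulr1; congr (_ + _).
rewrite -mulrN big_map -sumrN !mulr_sumr; apply: eq_big_seq => q qk.
have nz : node c rho q - (h / 2 + sgn_at mu p) != 0.
  by apply: (node_neq c qk) => // l lk; exact: gm.
have sk' : (-1) ^+ m = - ((-1) ^+ s * (-1) ^+ (~~ e)) :> K.
  by rewrite signrN mulrN opprK.
have W := weightE c g gk (sep_shift_at c p gm) qk sk'.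
have D := @ccoef_Qcoef R c m kap rho mu q p qk jk.
rewrite invfM [X in _ = _ * - X]mulrA.
set z := node c rho q in nz W D *; set z0 := h / 2 + _ in nz D *.
rewrite [RHS](_ : _ = - (Qcoef c m rho mu p * (z - z0)^-1 * h *
   (h^-1 * (cnum c m (~~ e) kap (shift_at c mu p) z
            / \prod_(y <- nodes c m rho | y != z) (z - y))))).
  rewrite -W; set cc := ccoef c m kap rho (shift_at c mu p) q in D *.
  have -> : ccoef c m kap rho mu q * Qcoef c m (shift_node c rho q) mu p =
     cc * Qcoef c m rho mu p * (z + h / 2 - sgn_at mu p) / (z - z0).
    by rewrite -D mulfK.
  rewrite (_ : z + h / 2 - sgn_at mu p = z - z0 + h); last first.
    by rewrite {2}(ic_halves c) /z0; ring.
  by field.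
set I := (\prod_(_ <- _ | _) _)^-1; move: I => I.
by field; rewrite (h_neq0 c0) nz.
Qed.

(** When the sign in front of mu is opposite to that of the shift, the factor of the shifted
    variable is z - z0 and so cancels the pole. *)
Lemma prod_shift_at n mu p z : (1 <= p.2 < n)%N ->
  \prod_(1 <= r < n) (z + (-1) ^+ (~~ p.1) * shift_at c mu p r + h / 2) =
  (z - (h / 2 + sgn_at mu p))
  * \prod_(1 <= r < n | r != p.2) (z + (-1) ^+ (~~ p.1) * mu r + h / 2).
Proof.
move=> jn; rewrite (prod_add_at (fun x => z + (-1) ^+ (~~ p.1) * x + h / 2) mu _ jn).
congr (_ * _); rewrite /sgn_at signrN.
transitivity (z - (-1) ^+ p.1 * mu p.2 - (-1) ^+ p.1 * (-1) ^+ p.1 * h + h / 2).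
  by ring.
by rewrite sgnM {1}(ic_halves c); ring.
Qed.

Lemma lagrange_lead_prods (Z : seq K) (s1 s2 : seq nat) (a b : nat -> K) d :
    uniq Z -> size Z = (size s1 + size s2).+1 ->
  \sum_(z <- Z) (\prod_(r <- s1) (z + a r + d) * \prod_(r <- s2) (z + b r + d))
     / \prod_(y <- Z | y != z) (z - y) = 1.
Proof.
move=> uZ sZ; rewrite -[RHS](@lagrange_lead _ Z
  ([seq - (a r + d) | r <- s1] ++ [seq - (b r + d) | r <- s2])) //.
  apply: eq_bigr => z _; rewrite big_cat !big_map /=.
  by congr (_ * _ / _); apply: eq_bigr => r _; rewrite opprK addrA.
by rewrite size_cat !size_map.
Qed.

Lemma lagrange_pole_prods (Z : seq K) (s1 s2 : seq nat) (a b : nat -> K) d z0 :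
    uniq (z0 :: Z) -> size Z = (size s1 + size s2)%N ->
  \sum_(z <- Z) (\prod_(r <- s1) (z + a r + d) * \prod_(r <- s2) (z + b r + d))
     / ((z - z0) * \prod_(y <- Z | y != z) (z - y)) =
  1 - (\prod_(r <- s1) (z0 + a r + d) * \prod_(r <- s2) (z0 + b r + d))
     / \prod_(y <- Z) (z0 - y).
Proof.
move=> uZ sZ.
have E z : \prod_(r <- s1) (z + a r + d) * \prod_(r <- s2) (z + b r + d) =
  \prod_(x <- [seq - (a r + d) | r <- s1] ++ [seq - (b r + d) | r <- s2]) (z - x).
  rewrite big_cat !big_map /=.
  by congr (_ * _); apply: eq_bigr => r _; rewrite opprK addrA.
rewrite E -lagrange_pole //; last by rewrite size_cat !size_map.
by apply: eq_bigr => z _; rewrite E.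
Qed.

Lemma size_iota_rem n j : (1 <= j < n.+1)%N ->
  size [seq r <- index_iota 1 n.+1 | r != j] = n.-1.
Proof.
move=> jn; have -> : [seq r <- index_iota 1 n.+1 | r != j] = rem j (index_iota 1 n.+1).
  by rewrite rem_filter ?iota_uniq.
by rewrite size_rem ?mem_index_iota // size_iota subn1.
Qed.

(** For this direction a factor of [cnum] cancels the pole; a numerator of degree 2k remains over
    2k+1 nodes, so the Lagrange sum is 1 and X is 1 + 1 times P. *)
Lemma Xfac_double k (s e : bool) mu nu lam p : gen_layer k nu ->
    sep_layers k nu k mu -> sep_layers k nu k.+1 lam ->
    (1 <= p.2 < k.+1)%N -> complex.Re (mu p.2) != 0 ->
    (-1) ^+ k = - ((-1) ^+ s * (-1) ^+ e) :> K -> p.1 = ~~ e ->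
  Xfac k s e mu nu lam p = 2 * Pcoef c k mu nu p.
Proof.
move=> g gm gl jk m0 sk pe; rewrite (XfacE g gm gl jk m0 sk).
rewrite (_ : \sum_(_ <- _) _ = 1); first by ring.
rewrite -[RHS](@lagrange_lead_prods (nodes c k nu) (index_iota 1 k.+2)
  [seq r <- index_iota 1 k.+1 | r != p.2] (fun r => (-1) ^+ e * lam r)
  (fun r => (-1) ^+ e * mu r) (h / 2)) ?uniq_nodes //; last first.
  rewrite size_nodes size_iota_rem // size_iota subn1 /=.
  have k0 : (0 < k)%N by case/andP: jk => j0 jk; exact: leq_trans j0 jk.
  by rewrite addSnnS prednK // addnn mul2n.
apply: eq_big_seq => z zn; rewrite big_filter /cnum.
have := prod_shift_at mu z jk; rewrite pe negbK => ->.
move/mapP : zn => [q qk ->].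
have nz : node c nu q - (h / 2 + sgn_at mu p) != 0.
  by apply: (node_neq c qk) => // l lk; exact: gm.
rewrite invfM; set d := _ - (h / 2 + _) in nz *.
set I := (\prod_(_ <- _ | _) _)^-1; move: I d nz => I d nz.
by field.
Qed.

(** Here mu is the upper neighbour of rho and comes with the sign [~~ e], so the pole cancels for
    the direction p.1 = e, leaving 1 - 1. *)
Lemma Yfac_eq0 m (s e : bool) kap rho mu p : gen_layer m rho ->
    sep_layers m rho m kap -> sep_layers m rho m.+1 mu ->
    (1 <= p.2 < m.+2)%N -> complex.Re (mu p.2) != 0 ->
    (-1) ^+ m = (-1) ^+ s * (-1) ^+ e :> K -> p.1 = e ->
  Yfac m s e kap rho mu p = 0.
Proof.
move=> g gk gm jk m0 sk pe; rewrite (YfacE g gk gm jk m0 sk).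
rewrite (_ : \sum_(_ <- _) _ = 1); first by ring.
rewrite -[RHS](@lagrange_lead_prods (nodes c m rho)
  [seq r <- index_iota 1 m.+2 | r != p.2] (index_iota 1 m.+1)
  (fun r => (-1) ^+ (~~ e) * mu r) (fun r => (-1) ^+ (~~ e) * kap r)
  (h / 2)) ?uniq_nodes //; last first.
  by rewrite size_nodes size_iota_rem // size_iota subn1 /= addnn mul2n.
apply: eq_big_seq => z zn; rewrite big_filter /cnum.
have := prod_shift_at mu z jk; rewrite pe => ->.
move/mapP : zn => [q qk ->].
have nz : node c rho q - (h / 2 + sgn_at mu p) != 0.
  by apply: (node_neq c qk) => // l lk; exact: gm.
rewrite invfM; set d := _ - (h / 2 + _) in nz *.
set I := (\prod_(_ <- _ | _) _)^-1; move: I d nz => I d nz.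
by field.
Qed.

(** By [lagrange_pole] the sum is 1 minus the contribution of the extra node z0; only this
    contribution survives. *)
Lemma Yfac_pole m (s e : bool) kap rho mu p : gen_layer m rho ->
    sep_layers m rho m kap -> sep_layers m rho m.+1 mu ->
    (1 <= p.2 < m.+2)%N -> complex.Re (mu p.2) != 0 ->
    (-1) ^+ m = (-1) ^+ s * (-1) ^+ e :> K ->
  let z0 := h / 2 + sgn_at mu p in
  Yfac m s e kap rho mu p = Qcoef c m rho mu p *
   (cnum c m (~~ e) kap (shift_at c mu p) z0 / \prod_(y <- nodes c m rho) (z0 - y)).
Proof.
move=> g gk gm jk m0 sk z0; rewrite (YfacE g gk gm jk m0 sk) /cnum.
rewrite (@lagrange_pole_prods (nodes c m rho) (index_iota 1 m.+2) (index_iota 1 m.+1)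
  (fun r => (-1) ^+ (~~ e) * shift_at c mu p r) (fun r => (-1) ^+ (~~ e) * kap r)
  (h / 2)); first by rewrite opprB addrC subrK.
  rewrite cons_uniq uniq_nodes // andbT; apply/mapP => -[q qk z0E].
  have : node c rho q - (h / 2 + sgn_at mu p) != 0.
    by apply: (node_neq c qk) => // l lk; exact: gm.
  by rewrite -z0E subrr eqxx.
by rewrite size_nodes !size_iota !subn1 /= addSn addnn mul2n.
Qed.

End Sums.

(** * The remaining sum over the variables of nu_{2k-1} *)

Section FinalSum.
Variables (R : realType) (c : R).
Hypothesis c0 : 0 < c.
Local Notation K := R[i].
Local Notation h := (ic c).
Implicit Types (kap rho mu nu lam : nat -> K) (e : bool) (p : bool * nat).

(* The factor by which the Whittaker function changes under the shift
   p = (~~ e, j), the direction for which Y does not vanish. *)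
Definition tneg m rho mu nu p : K :=
  (\prod_(1 <= r < m.+2) (nu r - sgn_at mu p - h / 2))^-1
  * \prod_(1 <= r < m.+1) (sgn_at mu p - rho r + h / 2).

(** Write M for [sgn_at mu p]. The nu-products of [tneg] and [Pcoef] cancel up to sign. The
    rho-products of [tneg] and [Qcoef] make up the node product at z0 except for its factor M + h.
    This factor, together with 2 and the factors M + (-1)^p.1 mu_r + h in the denominator of
    [Pcoef], cancels the mu-part of [cnum]. *)
Lemma term_collapse m (s e : bool) kap rho mu nu p :
    gen_layer m rho -> gen_layer m.+1 mu ->
    sep_layers m rho m kap -> sep_layers m rho m.+1 mu ->
    sep_layers m.+1 nu m.+1 mu ->
    (1 <= p.2 < m.+2)%N -> (-1) ^+ m = (-1) ^+ s * (-1) ^+ e :> K ->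
    p.1 = ~~ e ->
  tneg m rho mu nu p * Pcoef c m.+1 mu nu p * Yfac c m s e kap rho mu p =
  - (-1) ^+ s / h *
  (\prod_(1 <= r < m.+1) (sgn_at mu p + (-1) ^+ p.1 * kap r + h)
   / \prod_(1 <= r < m.+2 | r != p.2) (sgn_at mu p - (-1) ^+ p.1 * mu r)).
Proof.
move=> g gm sk sm sn jk sg pe; have [m0 gj] := gm _ jk.
rewrite (Yfac_pole c0 g sk sm jk m0 sg) -pe prod_nodes /tneg /Pcoef /Qcoef /cnum.
set M := sgn_at mu p.
have ReM : complex.Re M = (-1) ^+ p.1 * complex.Re (mu p.2) by rewrite /M /sgn_at Re_sign.
have -> : \prod_(1 <= r < m.+2) (M - nu r + h / 2) =
    (-1) ^+ m.+1 * \prod_(1 <= r < m.+2) (nu r - M - h / 2).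
  by rewrite -prodN_nat; apply: eq_bigr => r _; ring.
rewrite (prod_add_at (fun x => h / 2 + M + (-1) ^+ p.1 * x + h / 2) mu _ jk).
have nz1 : \prod_(1 <= r < m.+2) (nu r - M - h / 2) != 0.
  rewrite prodf_seq_neq0; apply/allP => r; rewrite mem_index_iota => rm.
  apply: (@sep_neq _ (nu r) (mu p.2)); first exact: sn.
  rewrite !(ReD, ReN) Re_h2 ReM.
  by case: (p.1); rewrite ?expr0 ?expr1; [left|right]; ring.
have nz2 : M + h != 0.
  apply: contraNneq m0 => /(congr1 (@complex.Re R)).
  by rewrite ReD Re_h ReM addr0 => /eqP; rewrite mulf_eq0 signr_eq0.
have nz3 : \prod_(1 <= r < m.+2 | r != p.2) (M + (-1) ^+ p.1 * mu r + h) != 0.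
  rewrite prodf_seq_neq0; apply/allP => r; rewrite mem_index_iota => rm.
  apply/implyP => rj; apply: (@sep_neq _ (mu p.2) (mu r)); first exact: gj.
  rewrite !(ReD, ReN) Re_h ReM Re_sign addr0.
  by case: (p.1); rewrite ?expr0 ?expr1; left; ring.
have rhoE : \prod_(1 <= r < m.+1) ((h / 2 + M) ^+ 2 - rho r ^+ 2) =
    \prod_(1 <= r < m.+1) (M - rho r + h / 2) * \prod_(1 <= r < m.+1) (M + rho r + h / 2).
  by rewrite -big_split; apply: eq_bigr => r _ /=; ring.
have nz4 : \prod_(1 <= r < m.+1) ((h / 2 + M) ^+ 2 - rho r ^+ 2) != 0.
  rewrite prodf_seq_neq0; apply/allP => r; rewrite mem_index_iota => rm.
  rewrite subr_sqr mulf_neq0 //; apply: (@sep_neq _ (rho r) (mu p.2)); try exact: sm;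
  rewrite !(ReD, ReN) Re_h2 ReM;
  by case: (p.1); rewrite ?expr0 ?expr1; (left; ring) || (right; ring).
rewrite big_split /=.
have sg1 : - (-1) ^+ p.1 * (-1) ^+ m.+1 = - (-1) ^+ s :> K.
  rewrite pe exprS sg signrN.
  by transitivity (- (-1) ^+ s * ((-1) ^+ e * (-1) ^+ e) : K); [ring|rewrite sgnM; ring].
have kapE : \prod_(1 <= r < m.+1) (h / 2 + M + (-1) ^+ p.1 * kap r + h / 2) =
    \prod_(1 <= r < m.+1) (M + (-1) ^+ p.1 * kap r + h).
  by apply: eq_bigr => r _; rewrite [in RHS](ic_halves c); ring.
have muE : \prod_(1 <= r < m.+2 | r != p.2) (h / 2 + M + (-1) ^+ p.1 * mu r + h / 2) =
    \prod_(1 <= r < m.+2 | r != p.2) (M + (-1) ^+ p.1 * mu r + h).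
  by apply: eq_bigr => r _; rewrite [in RHS](ic_halves c); ring.
(* For the shifted variable the two signs multiply to 1, so M and h each occur twice; the resulting
   2 cancels that of [Pcoef]. *)
have jE : h / 2 + M + (-1) ^+ p.1 * (mu p.2 + (-1) ^+ p.1 * h) + h / 2 = 2 * (M + h).
  transitivity (M + (-1) ^+ p.1 * mu p.2 + ((-1) ^+ p.1 * (-1) ^+ p.1) * h + (h / 2 + h / 2)).
    by ring.
  by rewrite sgnM -ic_halves /M /sgn_at; ring.
have zE : h / 2 + M + h / 2 = M + h by rewrite [in RHS](ic_halves c); ring.
rewrite kapE muE jE zE -sg1.
move: nz4; rewrite rhoE mulf_eq0 negb_or => /andP[nz5 nz6].
have nz7 : \prod_(1 <= r < m.+2 | r != p.2) (M - (-1) ^+ p.1 * mu r) != 0.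
  rewrite prodf_seq_neq0; apply/allP => r; rewrite mem_index_iota => rm.
  apply/implyP => rj; apply: (@sep_neq _ (mu p.2) (mu r)); first exact: gj.
  rewrite !(ReD, ReN) ReM Re_sign.
  by case: (p.1); rewrite ?expr0 ?expr1; right; ring.
move: (\prod_(_ <= _ < _) (nu _ - _ - _)) nz1 => A nz1.
move: (\prod_(_ <= _ < _) (M - rho _ + _)) nz5 => B nz5.
move: (\prod_(_ <= _ < _) (M + rho _ + _)) nz6 => C nz6.
move: (\prod_(_ <= _ < _ | _) (M + _ * mu _ + _)) nz3 => D nz3.
move: (\prod_(_ <= _ < _ | _) (M - _)) nz7 => E nz7.
move: (\prod_(_ <= _ < _) _) => F.
have hn := h_neq0 c0.
move: (M + h) nz2 => G nz2; move: ((-1) ^+ p.1) ((-1) ^+ m.+1) => u v.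
by field; rewrite nz1 nz2 nz3 nz5 nz6 nz7 hn.
Qed.

(** The collapsed terms form a Lagrange sum over the m + 1 nodes (-1)^(~~ e) mu_r with a monic
    numerator of degree m, which [lagrange_lead] evaluates to 1. *)
Lemma sum_collapse m (s e : bool) kap rho mu nu :
    gen_layer m rho -> gen_layer m.+1 mu ->
    sep_layers m rho m kap -> sep_layers m rho m.+1 mu ->
    sep_layers m.+1 nu m.+1 mu ->
    (-1) ^+ m = (-1) ^+ s * (-1) ^+ e :> K ->
  \sum_(1 <= j < m.+2) tneg m rho mu nu (~~ e, j) * Pcoef c m.+1 mu nu (~~ e, j)
     * Yfac c m s e kap rho mu (~~ e, j) = - (-1) ^+ s / h.
Proof.
move=> g gm sk sm sn sg.
under eq_big_nat => j jk do
  rewrite (@term_collapse m s e kap rho mu nu (~~ e, j) g gm sk sm sn jk sg erefl) /=.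
rewrite -mulr_sumr -[RHS]mulr1; congr (_ * _).
set x := fun r => (-1) ^+ (~~ e) * mu r.
have xinj : {in index_iota 1 m.+2 &, injective x}.
  move=> i j; rewrite !mem_index_iota => im jm xij.
  apply/eqP; apply: contraT => ij; have := (gm j jm).2 i im ij.
  by move/mulfI : xij => ->; rewrite ?signr_eq0 // /sep eqxx.
rewrite -[RHS](@lagrange_lead _ [seq x r | r <- index_iota 1 m.+2]
  [seq - ((-1) ^+ (~~ e) * kap r + h) | r <- index_iota 1 m.+1]); first last.
- by rewrite !size_map !size_iota !subn1.
- by rewrite map_inj_in_uniq // iota_uniq.
rewrite big_map; apply: eq_big_seq => j jm; congr (_ / _).
  by rewrite big_map; apply: eq_bigr => r _; rewrite opprK addrA.
rewrite big_map big_seq_cond [RHS]big_seq_cond; apply: eq_bigl => r.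
apply: andb_id2l => rm; congr (~~ _); apply/eqP/eqP => [->//|]; exact: xinj.
Qed.

End FinalSum.

(** * The action on functions of the Gelfand-Tsetlin variables *)

Section Coordinates.
Variables (R : realType) (n : nat) (c : R).
Local Notation K := R[i].
Local Notation h := (ic c).
Implicit Types (x y : nu_space R n) (a b i j : nat) (d : K).

Lemma nu_label_inj : injective (@nu_label n).
Proof.
move=> [a j] [b i]; rewrite /nu_label /= => -[ab].
have {}ab : a = b by exact: val_inj.
by subst b => /= ji; congr Tagged; exact: val_inj.
Qed.

Lemma nu_pick x (p : gtidx n) : nu x (tag p).+1 (tagged p).+1 = x 0 (enum_rank p).
Proof.
rewrite /nu; case: pickP => [q /eqP qp|/(_ p)]; last by rewrite eqxx.
by rewrite (@nu_label_inj q p qp).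
Qed.

Lemma label_ex a j : (1 <= a <= 2 * n)%N -> (1 <= j < (uphalf a).+1)%N ->
  exists p : gtidx n, nu_label p = (a, j).
Proof.
case: a => // a /= an; case: j => // j /= ja.
by exists (existT (fun a : 'I_(2 * n) => 'I_(uphalf a.+1)) (Ordinal an)
  (Ordinal (ja : (j < uphalf a.+1)%N))).
Qed.

Lemma nu_shift_neq x a b j d : a != b -> nu (nu_shift a j d x) b = nu x b.
Proof.
move=> ab; apply/funext => r; rewrite /nu; case: pickP => // p /eqP pE.
by rewrite mxE enum_rankK pE xpair_eqE eq_sym (negPf ab) addr0.
Qed.

Lemma nu_shift_eq x a j d : (1 <= a <= 2 * n)%N -> (1 <= j < (uphalf a).+1)%N ->
  nu (nu_shift a j d x) a = add_at (nu x a) j d.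
Proof.
move=> an ja; apply/funext => r; rewrite /nu /add_at; case: pickP => [p /eqP pE|np].
  by rewrite mxE enum_rankK pE xpair_eqE eqxx.
have [rj|rj] := eqVneq r j; last by rewrite addr0.
by have [p pE] := label_ex an ja; move: (np p); rewrite rj pE eqxx.
Qed.

Lemma nu_shiftC x a j d b i d' :
  nu_shift a j d (nu_shift b i d' x) = nu_shift b i d' (nu_shift a j d x).
Proof. by apply/rowP => q; rewrite !mxE addrAC. Qed.

Lemma generic_shift x a j (e : bool) : generic x -> generic (nu_shift a j ((-1) ^+ e * h) x).
Proof.
move=> gx p q; have [gp gm gs] := gx p q.
have reE r : complex.Re (nu_shift a j ((-1) ^+ e * h) x 0 r) = complex.Re (x 0 r).
  rewrite mxE ReD; case: ifP => _; last by rewrite addr0.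
  by rewrite Re_sign Re_h mulr0 addr0.
split.
- by rewrite reE.
- by move/gm; rewrite !ReD !ReN !reE.
- by move/gs; rewrite !ReD !reE.
Qed.

Lemma generic_sep x a j b i : generic x ->
  (1 <= a <= 2 * n)%N -> (1 <= j < (uphalf a).+1)%N ->
  (1 <= b <= 2 * n)%N -> (1 <= i < (uphalf b).+1)%N -> (a, j) != (b, i) ->
  sep (nu x a j) (nu x b i).
Proof.
move=> gx an ja bn ib ab.
have [p pE] := label_ex an ja; have [q qE] := label_ex bn ib.
have pq : p != q by apply: contraNneq ab => pq; rewrite -pE -qE pq.
move: pE qE => [<- <-] [<- <-]; rewrite !nu_pick.
have [_ /(_ pq) gm /(_ pq) gs] := gx p q.
by rewrite /sep -subr_eq0 subr_sqr mulf_neq0 // -?ReN -ReD.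
Qed.

Lemma generic_Re x a j : generic x ->
  (1 <= a <= 2 * n)%N -> (1 <= j < (uphalf a).+1)%N -> complex.Re (nu x a j) != 0.
Proof.
move=> gx an ja; have [p [<- <-]] := label_ex an ja; rewrite nu_pick.
by have [] := gx p p.
Qed.

Lemma uphalf_even k : uphalf (2 * k) = k.
Proof. by rewrite mul2n uphalf_double. Qed.

Lemma uphalf_odd k : uphalf (2 * k + 1) = k.+1.
Proof. by rewrite mul2n addn1 /= doubleK. Qed.

Lemma gen_layer_generic x a k : generic x -> (a <= 2 * n)%N -> uphalf a = k ->
  gen_layer k (nu x a).
Proof.
move=> gx an ak l lk.
have a0 : (1 <= a <= 2 * n)%N.
  by rewrite an andbT lt0n; apply: contraTneq lk => a0; rewrite -ak a0; case: (l) => [|[]].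
split; first by apply: generic_Re => //; rewrite ak.
move=> r rk rl; apply: generic_sep => //; rewrite ?ak // xpair_eqE eqxx /=.
by rewrite eq_sym.
Qed.

Lemma sep_layers_generic x a k b k' : generic x -> (a <= 2 * n)%N -> uphalf a = k ->
  (b <= 2 * n)%N -> uphalf b = k' -> a != b ->
  sep_layers k (nu x a) k' (nu x b).
Proof.
move=> gx an ak bn bk ab l lk r rk.
have p0 a' k'' l' : (a' <= 2 * n)%N -> uphalf a' = k'' -> (1 <= l' < k''.+1)%N ->
    (1 <= a' <= 2 * n)%N.
  move=> an' ak' lk'; rewrite an' andbT lt0n; apply: contraTneq lk' => a0.
  by rewrite -ak' a0; case: (l') => [|[]].
apply: generic_sep; rewrite ?ak ?bk //; [exact: p0 lk|exact: p0 rk|].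
by rewrite xpair_eqE (negPf ab).
Qed.

Definition node_shift k (q : option (bool * nat)) x :=
  if q is Some (b, l) then nu_shift (2 * k) l ((-1) ^+ b * h) x else x.

Definition at_shift m (p : bool * nat) x := nu_shift (2 * m + 1) p.2 ((-1) ^+ p.1 * h) x.

Definition at_idx m : seq (bool * nat) :=
  [seq (false, j) | j <- index_iota 1 m.+2] ++ [seq (true, j) | j <- index_iota 1 m.+2].

Lemma at_idxP m p : p \in at_idx m -> (1 <= p.2 < m.+2)%N.
Proof. by rewrite mem_cat => /orP[] /mapP[j]; rewrite mem_index_iota => jm ->. Qed.

Lemma I_even_sum k f x : I_even c k f x =
  \sum_(q <- node_idx k)
    ccoef c k (nu x (2 * k - 1)) (nu x (2 * k)) (nu x (2 * k + 1)) q * f (node_shift k q x).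
Proof.
rewrite /I_even /node_idx [RHS]big_cons big_cat !big_map /= [RHS]addrC; congr (_ + _).
rewrite !mulr_sumr; congr (_ + _); apply: eq_bigr => l _.
  by rewrite expr0 !mul1r !mulrA.
rewrite expr1 !mulN1r !mulrA; congr (_ / _ * _).
  by congr (_ * _); apply: eq_bigr => r _; congr (_ - _); rewrite -sqrrN opprB addrC.
by congr (_ * _); ring.
Qed.

(** Stated at k = m + 1, so that 2k - 1 and 2k - 2 become 2m + 1 and 2m. For the backward shifts, m
    and m + 1 signs come out of the two numerator products and an even number out of the
    denominator; this accounts for the sign in [Pcoef]. *)
Lemma I_odd_sum m f x : I_odd c m.+1 f x =
  \sum_(p <- at_idx m)
    Pcoef c m.+1 (nu x (2 * m + 1)) (nu x (2 * m.+1)) p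
    * Qcoef c m (nu x (2 * m)) (nu x (2 * m + 1)) p * f (at_shift m p x).
Proof.
have e1 : (2 * m.+1 - 1 = 2 * m + 1)%N by rewrite mulnSr -addnBA.
have e2 : (2 * m.+1 - 2 = 2 * m)%N by rewrite mulnSr addnK.
rewrite /I_odd e1 e2 big_cat !big_map /=.
congr (_ + _).
  rewrite mulr_sumr; apply: eq_bigr => j _.
  rewrite /Pcoef /Qcoef /at_shift /sgn_at /= expr0 !mul1r.
  rewrite (eq_bigr (fun r => nu x (2 * m + 1) j + nu x (2 * m) r + h / 2)) => [|r _];
    last by ring.
  rewrite [X in 2 * X](eq_bigr (fun r => (nu x (2 * m + 1) j - 1 * nu x (2 * m + 1) r) *
    (nu x (2 * m + 1) j + 1 * nu x (2 * m + 1) r + h))) => [|r _];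
    last by rewrite !mul1r.
  by ring.
rewrite -mulNr mulr_sumr; apply: eq_bigr => j _.
rewrite /Pcoef /Qcoef /at_shift /sgn_at /= expr1 !mulN1r.
rewrite [X in X * _ / _](_ : _ = (-1) ^+ m *
    \prod_(1 <= r < m.+1) (- nu x (2 * m + 1) j + nu x (2 * m) r + h / 2)); last first.
  by rewrite -prodN_nat; apply: eq_bigr => r _; ring.
rewrite [X in _ * X / _](_ : _ = (-1) ^+ m.+1 *
    \prod_(1 <= r < m.+2) (- nu x (2 * m + 1) j - nu x (2 * m.+1) r + h / 2)); last first.
  by rewrite -prodN_nat; apply: eq_bigr => r _; ring.
rewrite [X in 2 * X](eq_bigr (fun r => (- nu x (2 * m + 1) j - -1 * nu x (2 * m + 1) r) *
    (- nu x (2 * m + 1) j + -1 * nu x (2 * m + 1) r + h))) => [|r _];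
    last by ring.
have sm : (-1) ^+ m * (-1) ^+ m = 1 :> K by rewrite -expr2 sqrr_sign.
rewrite exprS.
set A := \prod_(_ <= _ < _) _; set B := \prod_(_ <= _ < _) _.
set C := \prod_(_ <= _ < _ | _) _.
transitivity ((-1) ^+ m * (-1) ^+ m * (h^-1 * (A * B / (2 * C)) *
  f (nu_shift (2 * m + 1) j (- h) x))); first by ring.
by rewrite sm; ring.
Qed.

End Coordinates.

(** * Ratios of shifted Whittaker functions *)

Section Ratios.
Variables (R : realType) (c : R).
Hypothesis c0 : 0 < c.
Local Notation K := R[i].
Local Notation h := (ic c).
Implicit Types (kap rho mu nu lam : nat -> K) (e b s : bool).

(** One factor of s(X; Y), as a function of z = x + y. *)
Definition gfun (z : K) : K := ic_pow c (z / h) * cGamma (z / h + 1 / 2).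

Lemma ic_pow1 : ic_pow c 1 = h.
Proof.
rewrite /ic_pow mul1r /cexp /= lnK ?posrE // cos_pihalf sin_pihalf /ic.
by simpc.
Qed.

(** The power contributes h and Gamma contributes z/h + 1/2, together z + h/2. The poles of Gamma
    occur at real multiples of h, which are imaginary and so excluded by the hypothesis. *)
Lemma gfunD z : complex.Re z != 0 -> gfun (z + h) = (z + h / 2) * gfun z.
Proof.
move=> z0; have hn := h_neq0 c0; rewrite /gfun mulrDl divff //.
rewrite {1}/ic_pow mulrDl cexpD -/(ic_pow c _) -/(ic_pow c 1) ic_pow1.
rewrite addrAC cGammaS; last first.
  move=> m; apply: contraNneq z0 => E.
  have -> : z = - (1 / 2 + m%:R) * h.
    by apply: (mulIf (invr_neq0 hn)); rewrite mulfK //; apply/eqP; rewrite -addr_eq0 addrA E.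
  have -> : - (1 / 2 + m%:R) = (- (1 / 2 + m%:R))%:C :> K.
    by rewrite rmorphN rmorphD rmorphM fmorphV rmorph1 !rmorph_nat.
  by rewrite /ic /=; apply/eqP; ring.
by field.
Qed.

Lemma gfunB z : complex.Re z != 0 -> gfun (z - h) = (z - h / 2)^-1 * gfun z.
Proof.
move=> z0.
have zh : complex.Re (z - h) != 0 by rewrite ReD ReN Re_h subr0.
have := gfunD zh; rewrite subrK (_ : z - h + h / 2 = z - h / 2); last by field.
move=> ->; rewrite mulKf //; apply: contraNneq z0 => /(congr1 (@complex.Re R)).
by rewrite ReD ReN Re_h2 subr0 => /= ->.
Qed.

Definition gratio b z : K := if b then (z - h / 2)^-1 else z + h / 2.

Lemma gfun_shift b z : complex.Re z != 0 ->
  gfun (z + (-1) ^+ b * h) = gratio b z * gfun z.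
Proof. by case: b => z0; rewrite ?mulN1r ?mul1r; [exact: gfunB|exact: gfunD]. Qed.

Definition Vs k e mu nu : K :=
  cexp (- (-1) ^+ e * (pi / (2 * c))%:C * \sum_(1 <= j < k.+1) nu j)
  * \prod_(1 <= r < k.+1) \prod_(1 <= l < k.+1) gfun ((-1) ^+ e * mu r + nu l).

Definition Us k e nu lam : K :=
  \prod_(1 <= l < k.+1) \prod_(1 <= r < k.+2) gfun (- nu l + (-1) ^+ e * lam r).

Lemma prod2_add_at n1 n2 (F : K -> nat -> K) f j d (q : nat -> K) : (1 <= j < n1)%N ->
    (forall r, (1 <= r < n2)%N -> F (f j + d) r = q r * F (f j) r) ->
  \prod_(1 <= i < n1) \prod_(1 <= r < n2) F (add_at f j d i) r =
  (\prod_(1 <= r < n2) q r) * \prod_(1 <= i < n1) \prod_(1 <= r < n2) F (f i) r.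
Proof.
move=> jn H; rewrite (prod_add_at (fun x => \prod_(1 <= r < n2) F x r) f d jn).
rewrite (prod_natD1 (fun i => \prod_(1 <= r < n2) F (f i) r) jn) mulrA; congr (_ * _).
by rewrite -big_split /=; apply: eq_big_nat.
Qed.

Lemma Re_sign_neq0 e e' (z w : K) : sep z w ->
  complex.Re ((-1) ^+ e * z + (-1) ^+ e' * w) != 0.
Proof.
move=> zw; apply: contraNneq zw => E; rewrite -subr_eq0 subr_sqr mulf_eq0.
move: E; rewrite ReD !Re_sign => E; apply/orP.
by move: E; case: e; case: e'; rewrite ?expr0 ?expr1 => E; [right|left|left|right];
  apply/eqP; lra.
Qed.

(** As h / c = i, the exponent is +-i pi/2; this is the origin of the factor +-i in [cratio]. *)
Lemma cexp_exponent e b :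
  cexp (- (-1) ^+ e * (pi / (2 * c))%:C * ((-1) ^+ b * h)) = - ((-1) ^+ b * (-1) ^+ e * 'i).
Proof.
have cn : c != 0 by rewrite gt_eqF.
have -> : - (-1) ^+ e * (pi / (2 * c))%:C * ((-1) ^+ b * h) =
    0 +i* ((-1) ^+ (e (+) b (+) true) * (pi / 2)).
  have -> : (pi / (2 * c))%:C = (pi / 2 / c)%:C by congr (_%:C); field.
  rewrite /ic; case: e; case: b; rewrite /= ?expr0 ?expr1; simpc;
    congr (_ +i* _); field; exact: cn.
rewrite /cexp /= expR0 mul1r.
by case: e; case: b; rewrite /= ?expr0 ?expr1 ?mul1r ?mulN1r ?cosN ?sinN
  ?cos_pihalf ?sin_pihalf; simpc.
Qed.

Lemma sum_add_at k nu l d : (1 <= l < k.+1)%N ->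
  \sum_(1 <= j < k.+1) add_at nu l d j = d + \sum_(1 <= j < k.+1) nu j.
Proof.
move=> lk; rewrite /add_at big_split /= addrC; congr (_ + _).
rewrite (bigD1_seq l) ?mem_index_iota ?iota_uniq //= eqxx big1 ?addr0 // => r rl.
by rewrite (negPf rl).
Qed.

Lemma Vs_add_at_nu k e b mu nu l : (1 <= l < k.+1)%N -> sep_layers k nu k mu ->
  Vs k e mu (add_at nu l ((-1) ^+ b * h)) =
  - ((-1) ^+ b * (-1) ^+ e * 'i)
  * (\prod_(1 <= r < k.+1) gratio b ((-1) ^+ e * mu r + nu l)) * Vs k e mu nu.
Proof.
move=> lk sm; rewrite /Vs sum_add_at // mulrDr cexpD cexp_exponent.
rewrite exchange_big /= [X in _ = _ * (_ * X)]exchange_big /=.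
rewrite (@prod2_add_at _ _ (fun x r => gfun ((-1) ^+ e * mu r + x)) _ _ _
   (fun r => gratio b ((-1) ^+ e * mu r + nu l)) lk); first by ring.
move=> r rk; rewrite addrA gfun_shift // addrC -[nu l]mul1r.
exact: (@Re_sign_neq0 false e _ _ (sm l lk r rk)).
Qed.

(** The variable enters through -nu_l, so its shift moves the argument of [gfun] the other way. *)
Lemma Us_add_at_nu k e b nu lam l : (1 <= l < k.+1)%N -> sep_layers k nu k.+1 lam ->
  Us k e (add_at nu l ((-1) ^+ b * h)) lam =
  (\prod_(1 <= r < k.+2) gratio (~~ b) (- nu l + (-1) ^+ e * lam r)) * Us k e nu lam.
Proof.
move=> lk sm; rewrite /Us.
rewrite (@prod2_add_at _ _ (fun x r => gfun (- x + (-1) ^+ e * lam r)) _ _ _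
   (fun r => gratio (~~ b) (- nu l + (-1) ^+ e * lam r)) lk) // => r rk.
rewrite opprD addrAC -mulNr -signrN gfun_shift // -[- nu l]mulN1r.
exact: (@Re_sign_neq0 true e _ _ (sm l lk r rk)).
Qed.

Lemma Vs_add_at_mu k e b mu nu j : (1 <= j < k.+1)%N -> sep_layers k nu k mu ->
  Vs k e (add_at mu j ((-1) ^+ b * h)) nu =
  (\prod_(1 <= r < k.+1) gratio (e (+) b) ((-1) ^+ e * mu j + nu r)) * Vs k e mu nu.
Proof.
move=> jk sm; rewrite /Vs.
rewrite (@prod2_add_at _ _ (fun x r => gfun ((-1) ^+ e * x + nu r)) _ _ _
   (fun r => gratio (e (+) b) ((-1) ^+ e * mu j + nu r)) jk); first by ring.
move=> r rk; rewrite mulrDr addrAC mulrA -signr_addb gfun_shift // addrC -[nu r]mul1r.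
exact: (@Re_sign_neq0 false e _ _ (sm r rk j jk)).
Qed.

Lemma Us_add_at_lam k e b nu lam j : (1 <= j < k.+2)%N -> sep_layers k nu k.+1 lam ->
  Us k e nu (add_at lam j ((-1) ^+ b * h)) =
  (\prod_(1 <= r < k.+1) gratio (e (+) b) (- nu r + (-1) ^+ e * lam j)) * Us k e nu lam.
Proof.
move=> jk sm; rewrite /Us exchange_big /= [X in _ = _ * X]exchange_big /=.
rewrite (@prod2_add_at _ _ (fun x r => gfun (- nu r + (-1) ^+ e * x)) _ _ _
   (fun r => gratio (e (+) b) (- nu r + (-1) ^+ e * lam j)) jk) // => r rk.
rewrite mulrDr addrA mulrA -signr_addb gfun_shift // -[- nu r]mulN1r.
exact: (@Re_sign_neq0 true e _ _ (sm r rk j jk)).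
Qed.

End Ratios.

(** * Shifts of the whole Whittaker function *)

Section Whittaker.
Variables (R : realType) (n : nat) (c : R).
Hypothesis c0 : 0 < c.
Local Notation K := R[i].
Local Notation h := (ic c).
Implicit Types (x y : nu_space R n) (e s : bool).

(** The sign of V_k and W_k is (-1)^(k+1) in w_n and (-1)^k in w_n'. As a boolean it combines with
    shift directions by exclusive or. *)
Definition layer_sign s k : bool := s (+) ~~ odd k.

(* s = false gives w_n and s = true gives w_n'. *)
Definition whitt s x : K :=
  delta_factor c x * (\prod_(1 <= k < n) W_factor c k ((-1) ^+ layer_sign s k) x)
  * V_factor c n ((-1) ^+ layer_sign s n) x.

Lemma whitt_false x : whittaker_w c x = whitt false x.
Proof.
rewrite /whittaker_w /whitt; congr (_ * _ * _); first apply: eq_bigr => k _;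
  by rewrite /layer_sign -signr_odd addn1.
Qed.

Lemma whitt_true x : whittaker_w' c x = whitt true x.
Proof.
rewrite /whittaker_w' /whitt; congr (_ * _ * _); first apply: eq_bigr => k _;
  by rewrite /layer_sign addTb negbK signr_odd.
Qed.

Lemma uphalf_pred k : (0 < k)%N -> uphalf (2 * k - 1) = k.
Proof. by case: k => // k _; rewrite mulnSr -addnBA // uphalf_odd. Qed.

Lemma V_factorE k e x : (0 < k)%N ->
  V_factor c k ((-1) ^+ e) x = Vs c k e (nu x (2 * k - 1)) (nu x (2 * k)).
Proof.
move=> k0; rewrite /V_factor /Vs /s_fun /nu_group /seq_scale uphalf_pred // uphalf_even.
rewrite !big_map /index_iota subn1 /=; congr (_ * _).
by apply: eq_bigr => r _; rewrite big_map.
Qed.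

Lemma W_factorE k e x : (0 < k)%N ->
  W_factor c k ((-1) ^+ e) x =
  Vs c k e (nu x (2 * k - 1)) (nu x (2 * k)) * Us c k e (nu x (2 * k)) (nu x (2 * k + 1)).
Proof.
move=> k0; rewrite /W_factor V_factorE //; congr (_ * _).
rewrite /Us /s_fun /nu_group /seq_scale uphalf_odd uphalf_even.
rewrite !big_map /index_iota !subSS !subn0; apply: eq_bigr => r _; rewrite !big_map.
by apply: eq_bigr => l _; rewrite mulN1r.
Qed.

(** The second product includes the trivial index k = 0, so that a shift of nu_1, which has no layer
    below, is not a special case. *)
Lemma whittE s x : (0 < n)%N -> whitt s x = delta_factor c x
  * (\prod_(1 <= k < n.+1) Vs c k (layer_sign s k) (nu x (2 * k - 1)) (nu x (2 * k)))
  * \prod_(0 <= k < n) Us c k (layer_sign s k) (nu x (2 * k)) (nu x (2 * k + 1)).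
Proof.
move=> n0; rewrite /whitt V_factorE // big_nat_recr //=.
have U0 e f g : Us c 0 e f g = 1 by rewrite /Us big_geq.
rewrite [X in _ = _ * X]big_ltn // U0 mul1r.
rewrite (eq_big_nat _ _ (F2 := fun k =>
  Vs c k (layer_sign s k) (nu x (2 * k - 1)) (nu x (2 * k)) *
  Us c k (layer_sign s k) (nu x (2 * k)) (nu x (2 * k + 1)))); last first.
  by move=> k /andP[k0 _]; rewrite W_factorE.
by rewrite big_split /=; ring.
Qed.

Lemma prod_nat_update a b k (F F' : nat -> K) q : (a <= k < b)%N ->
    (forall i, i != k -> F' i = F i) -> F' k = q * F k ->
  \prod_(a <= i < b) F' i = q * \prod_(a <= i < b) F i.
Proof.
move=> kab H Hk; rewrite !(prod_natD1 _ kab) Hk -mulrA; congr (_ * (_ * _)).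
by apply: eq_bigr => i /H.
Qed.

(** None of the operators considered shifts nu_{2n}, the only group occurring in this factor, which
    therefore behaves as a constant. *)
Lemma delta_shift x a j d : a != (2 * n)%N ->
  delta_factor c (nu_shift a j d x) = delta_factor c x.
Proof. by move=> an; rewrite /delta_factor nu_shift_neq. Qed.

(** For k < n the group nu_{2k} occurs only in [Vs] and [Us] of the layer k, with opposite signs:
    one of them yields a product, the other reciprocals. *)
Lemma whitt_node_shift s k q x : (k < n)%N -> q \in node_idx k -> generic x ->
  whitt s (node_shift c k q x) =
  cratio c k (layer_sign s k) (nu x (2 * k - 1)) (nu x (2 * k)) (nu x (2 * k + 1)) q
  * whitt s x.
Proof.
move=> kn /node_idxP[->|[b [l [lk ->]]]] gx; first by rewrite mul1r.
have n0 : (0 < n)%N by exact: leq_ltn_trans kn.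
have k0 : (0 < k)%N by case/andP: lk => l0 lk; exact: leq_trans l0 lk.
rewrite /node_shift !whittE // delta_shift; last by rewrite eqn_pmul2l // neq_ltn kn.
have k2 : (1 <= 2 * k <= 2 * n)%N by rewrite muln_gt0 k0 /= leq_mul2l ltnW.
have lk' : (1 <= l < (uphalf (2 * k)).+1)%N by rewrite uphalf_even.
have sl i' : (i' != k) -> nu (nu_shift (2 * k) l ((-1) ^+ b * h) x) (2 * i') = nu x (2 * i').
  by move=> ik; rewrite nu_shift_neq // eqn_pmul2l // eq_sym.
have odd1 i : nu (nu_shift (2 * k) l ((-1) ^+ b * h) x) (2 * i + 1) = nu x (2 * i + 1).
  rewrite nu_shift_neq //; apply/negP => /eqP/(congr1 odd).
  by rewrite oddD !oddM.
have odd2 i : nu (nu_shift (2 * k) l ((-1) ^+ b * h) x) (2 * i - 1) = nu x (2 * i - 1).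
  case: i => [|i]; last by rewrite mulnSr -addnBA // odd1.
  by rewrite nu_shift_neq // muln0 -lt0n; case/andP: k2.
rewrite (@prod_nat_update 1 n.+1 k
  (fun k => Vs c k (layer_sign s k) (nu x (2 * k - 1)) (nu x (2 * k))) _
  (- ((-1) ^+ b * (-1) ^+ layer_sign s k * 'i)
  * (\prod_(1 <= r < k.+1)
      gratio c b ((-1) ^+ layer_sign s k * nu x (2 * k - 1) r + nu x (2 * k) l)))); first last.
- rewrite odd2 nu_shift_eq // Vs_add_at_nu //.
  by apply: sep_layers_generic => //; rewrite ?uphalf_even ?uphalf_pred //; lia.
- by move=> i ik; rewrite odd2 sl.
- by rewrite k0 ltnS ltnW.
rewrite (@prod_nat_update 0 n k
  (fun k => Us c k (layer_sign s k) (nu x (2 * k)) (nu x (2 * k + 1))) _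
  (\prod_(1 <= r < k.+2)
      gratio c (~~ b) (- nu x (2 * k) l + (-1) ^+ layer_sign s k * nu x (2 * k + 1) r)));
  first last.
- rewrite odd1 nu_shift_eq // Us_add_at_nu //.
  by apply: sep_layers_generic => //; rewrite ?uphalf_even ?uphalf_odd //; lia.
- by move=> i ik; rewrite odd1 sl.
- by rewrite kn.
rewrite /cratio /gratio; set e := layer_sign s k.
case: (b) => /=; rewrite ?expr0 ?expr1 prodfV.
  have -> : \prod_(1 <= r < k.+1) ((-1) ^+ e * nu x (2 * k - 1) r + nu x (2 * k) l - h / 2) =
    \prod_(1 <= r < k.+1) ((-1) ^+ e * nu x (2 * k - 1) r - -1 * nu x (2 * k) l - h / 2).
    by apply: eq_bigr => r _; ring.
  have -> : \prod_(1 <= r < k.+2) (- nu x (2 * k) l + (-1) ^+ e * nu x (2 * k + 1) r + h / 2) =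
    \prod_(1 <= r < k.+2) (-1 * nu x (2 * k) l + (-1) ^+ e * nu x (2 * k + 1) r + h / 2).
    by apply: eq_bigr => r _; ring.
  by ring.
have -> : \prod_(1 <= r < k.+1) ((-1) ^+ e * nu x (2 * k - 1) r + nu x (2 * k) l + h / 2) =
    \prod_(1 <= r < k.+1) (1 * nu x (2 * k) l + (-1) ^+ e * nu x (2 * k - 1) r + h / 2).
  by apply: eq_bigr => r _; ring.
have -> : \prod_(1 <= r < k.+2) (- nu x (2 * k) l + (-1) ^+ e * nu x (2 * k + 1) r - h / 2) =
    \prod_(1 <= r < k.+2) ((-1) ^+ e * nu x (2 * k + 1) r - 1 * nu x (2 * k) l - h / 2).
  by apply: eq_bigr => r _; ring.
by ring.
Qed.

(** The group nu_{2m+1} occurs in [Vs] of the layer m + 1 and in [Us] of the layer m, whose signs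
    are opposite. *)
Definition at_ratio s m p x : K :=
  let e := layer_sign s m.+1 in
  (\prod_(1 <= r < m.+2)
     gratio c (e (+) p.1) ((-1) ^+ e * nu x (2 * m + 1) p.2 + nu x (2 * m.+1) r))
  * \prod_(1 <= r < m.+1)
     gratio c (~~ e (+) p.1) (- nu x (2 * m) r + (-1) ^+ (~~ e) * nu x (2 * m + 1) p.2).

Lemma layer_signS s k : layer_sign s k = ~~ layer_sign s k.+1.
Proof. by rewrite /layer_sign /=; case: s; case: (odd k). Qed.

Lemma whitt_at_shift s m p x : (m < n)%N -> (1 <= p.2 < m.+2)%N -> generic x ->
  whitt s (at_shift c m p x) = at_ratio s m p x * whitt s x.
Proof.
move=> mn jm gx; case: p jm => b j /= jm.
have n0 : (0 < n)%N by exact: leq_ltn_trans mn.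
rewrite /at_shift /= !whittE // delta_shift; last by lia.
have m2 : (1 <= 2 * m + 1 <= 2 * n)%N by lia.
have jm' : (1 <= j < (uphalf (2 * m + 1)).+1)%N by rewrite uphalf_odd.
have odd1 i : i != m ->
    nu (nu_shift (2 * m + 1) j ((-1) ^+ b * h) x) (2 * i + 1) = nu x (2 * i + 1).
  by move=> im; rewrite nu_shift_neq //; lia.
have odd2 i : i != m.+1 ->
    nu (nu_shift (2 * m + 1) j ((-1) ^+ b * h) x) (2 * i - 1) = nu x (2 * i - 1).
  by move=> im; rewrite nu_shift_neq //; lia.
have even i :
    nu (nu_shift (2 * m + 1) j ((-1) ^+ b * h) x) (2 * i) = nu x (2 * i).
  by rewrite nu_shift_neq //; lia.
have e1 : (2 * m.+1 - 1 = 2 * m + 1)%N by lia.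
rewrite (@prod_nat_update 1 n.+1 m.+1
  (fun k => Vs c k (layer_sign s k) (nu x (2 * k - 1)) (nu x (2 * k))) _
  (\prod_(1 <= r < m.+2) gratio c (layer_sign s m.+1 (+) b)
     ((-1) ^+ layer_sign s m.+1 * nu x (2 * m + 1) j + nu x (2 * m.+1) r))); first last.
- rewrite e1 even nu_shift_eq // Vs_add_at_mu //.
  by apply: sep_layers_generic => //; rewrite ?uphalf_even ?uphalf_odd //; lia.
- by move=> i ik; rewrite odd2 // even.
- by lia.
rewrite (@prod_nat_update 0 n m
  (fun k => Us c k (layer_sign s k) (nu x (2 * k)) (nu x (2 * k + 1))) _
  (\prod_(1 <= r < m.+1) gratio c (layer_sign s m (+) b)
     (- nu x (2 * m) r + (-1) ^+ layer_sign s m * nu x (2 * m + 1) j))); first last.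
- rewrite even nu_shift_eq // Us_add_at_lam //.
  by apply: sep_layers_generic => //; rewrite ?uphalf_even ?uphalf_odd //; lia.
- by move=> i ik; rewrite even odd1.
- by lia.
by rewrite /at_ratio /= -!layer_signS; ring.
Qed.

Lemma at_ratio_neg s m j x : let e := layer_sign s m.+1 in
  at_ratio s m (~~ e, j) x =
  tneg c m (nu x (2 * m)) (nu x (2 * m + 1)) (nu x (2 * m.+1)) (~~ e, j).
Proof.
move=> e; rewrite /at_ratio /tneg /sgn_at -/e /=.
rewrite addbN addNb addbN addbb negbK /= -prodfV /gratio; congr (_ * _).
  by apply: eq_bigr => r _; rewrite signrN; congr (_^-1); ring.
by apply: eq_bigr => r _; ring.
Qed.

(** This is the sign hypothesis of [Yfac_eq0] and [sum_collapse]; multiplied by -1 it becomes that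
    of [Xfac_double] at k = m + 1. *)
Lemma layer_sign_exp s m :
  (-1) ^+ m = (-1) ^+ s * (-1) ^+ layer_sign s m.+1 :> K.
Proof. by rewrite -signr_addb /layer_sign addKb /= negbK signr_odd. Qed.

Lemma sum_at_idx m e (F : bool * nat -> K) :
    (forall p, (1 <= p.2 < m.+2)%N -> p.1 = e -> F p = 0) ->
  \sum_(p <- at_idx m) F p = \sum_(1 <= j < m.+2) F (~~ e, j).
Proof.
move=> F0; rewrite big_cat !big_map /=.
have z : \sum_(1 <= j < m.+2) F (e, j) = 0.
  by rewrite big_nat big1 // => j jm; rewrite F0.
by case: e z {F0} => z; rewrite z ?addr0 ?add0r.
Qed.

End Whittaker.

(** * Eigenvalues *)

Section Eigen.
Variables (R : realType) (n : nat) (c : R).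
Hypothesis c0 : 0 < c.
Local Notation K := R[i].
Local Notation h := (ic c).
Implicit Types (x y : nu_space R n) (e s : bool).

Lemma double_odd m : (2 * m.+1 - 1 = 2 * m + 1)%N.
Proof. by lia. Qed.

(** * The layer k = m + 1 and its neighbours *)

Section Layer.
Variables (s : bool) (m : nat).
Hypothesis mn : (m < n)%N.
Let e := layer_sign s m.+1.

Let P (p : bool * nat) y : K := Pcoef c m.+1 (nu y (2 * m + 1)) (nu y (2 * m.+1)) p.
Let Q (p : bool * nat) y : K := Qcoef c m (nu y (2 * m)) (nu y (2 * m + 1)) p.
Let b (q : option (bool * nat)) y : K :=
  ccoef c m (nu y (2 * m - 1)) (nu y (2 * m)) (nu y (2 * m + 1)) q.
Let cc (q : option (bool * nat)) y : K :=
  ccoef c m.+1 (nu y (2 * m + 1)) (nu y (2 * m.+1)) (nu y (2 * m.+1 + 1)) q.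
Let t := at_ratio c s m : bool * nat -> nu_space R n -> K.
Let v (q : option (bool * nat)) y : K :=
  cratio c m (~~ e) (nu y (2 * m - 1)) (nu y (2 * m)) (nu y (2 * m + 1)) q.
Let u (q : option (bool * nat)) y : K :=
  cratio c m.+1 e (nu y (2 * m + 1)) (nu y (2 * m.+1)) (nu y (2 * m.+1 + 1)) q.
Let ta := at_shift c m : bool * nat -> nu_space R n -> nu_space R n.
Let tb := node_shift c m : option (bool * nat) -> nu_space R n -> nu_space R n.
Let tc := node_shift c m.+1 : option (bool * nat) -> nu_space R n -> nu_space R n.
Let w := whitt c s : nu_space R n -> K.

Let AE f y : I_odd c m.+1 f y = \sum_(p <- at_idx m) P p y * Q p y * f (ta p y).
Proof. exact: I_odd_sum. Qed.

Let BE f y : I_even c m f y = \sum_(q <- node_idx m) b q y * f (tb q y).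
Proof. exact: I_even_sum. Qed.

Let CE f y : I_even c m.+1 f y = \sum_(q <- node_idx m.+1) cc q y * f (tc q y).
Proof. by rewrite I_even_sum double_odd. Qed.

Let nu_tb q y a : a != (2 * m)%N -> nu (tb q y) a = nu y a.
Proof. by case: q => [[e' l]|] // am; rewrite /tb /= nu_shift_neq // eq_sym. Qed.

Let nu_tc q y a : a != (2 * m.+1)%N -> nu (tc q y) a = nu y a.
Proof. by case: q => [[e' l]|] // am; rewrite /tc /= nu_shift_neq // eq_sym. Qed.

Let nu_ta p y a : a != (2 * m + 1)%N -> nu (ta p y) a = nu y a.
Proof. by move=> am; rewrite /ta /at_shift nu_shift_neq // eq_sym. Qed.

Let nu_ta_at p y : (1 <= p.2 < m.+2)%N ->
  nu (ta p y) (2 * m + 1) = shift_at c (nu y (2 * m + 1)) p.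
Proof. by move=> jm; rewrite /ta /at_shift nu_shift_eq //; [lia|rewrite uphalf_odd]. Qed.

Let Ga p y : generic y -> generic (ta p y).
Proof. exact: generic_shift. Qed.

Let Gc q y : generic y -> generic (tc q y).
Proof. by case: q => [[e' l]|] //; exact: generic_shift. Qed.

Let Pb p r y : P p (tb r y) = P p y.
Proof. by rewrite /P !nu_tb //; lia. Qed.

Let tab p r y : ta p (tb r y) = tb r (ta p y).
Proof. by case: r => [[e' l]|] //; exact: nu_shiftC. Qed.

Let wa p y : p \in at_idx m -> generic y -> w (ta p y) = t p y * w y.
Proof. by move=> /at_idxP jm gy; exact: whitt_at_shift. Qed.

Let wb r y : r \in node_idx m -> generic y -> w (tb r y) = v r y * w y.
Proof. by move=> rm gy; rewrite /w whitt_node_shift // /v /e -layer_signS. Qed.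

Let gen x (gx : generic x) : 
  [/\ gen_layer m (nu x (2 * m)), gen_layer m.+1 (nu x (2 * m + 1)),
      sep_layers m (nu x (2 * m)) m (nu x (2 * m - 1)),
      sep_layers m (nu x (2 * m)) m.+1 (nu x (2 * m + 1)) &
      sep_layers m.+1 (nu x (2 * m.+1)) m.+1 (nu x (2 * m + 1))].
Proof.
split.
- by apply: gen_layer_generic => //; rewrite ?uphalf_even //; lia.
- by apply: gen_layer_generic => //; rewrite ?uphalf_odd //; lia.
(* For m = 0 the labels 2m and 2m - 1 are both 0, by truncated subtraction, and the layer is
   empty. *)
- have [m0|m0] := posnP m; first by rewrite m0 => l; case: l.
  by apply: sep_layers_generic => //; rewrite ?uphalf_even ?uphalf_pred //; lia.
- by apply: sep_layers_generic => //; rewrite ?uphalf_even ?uphalf_odd //; lia.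
- by apply: sep_layers_generic => //; rewrite ?uphalf_even ?uphalf_odd //; lia.
Qed.

Let YE x p : (1 <= p.2 < m.+2)%N ->
  Q p x + (-1) ^+ s * 'i * \sum_(r <- node_idx m)
     (Q p x * b r (ta p x) - b r x * Q p (tb r x)) * v r (ta p x) =
  Yfac c m s e (nu x (2 * m - 1)) (nu x (2 * m)) (nu x (2 * m + 1)) p.
Proof.
move=> jm; rewrite /Yfac; congr (_ + _ * _); apply: eq_big_seq => r rm.
rewrite /b /Q /v nu_ta_at // !nu_ta; try lia.
rewrite (@nu_tb _ _ (2 * m + 1)); last lia.
congr ((_ - _ * Qcoef _ _ _ _ _) * _).
case/node_idxP : rm => [->//|[e' [l [lm ->]]]].
rewrite /tb /= nu_shift_eq // ?uphalf_even //.
by lia.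
Qed.

Let XE x p : (m.+1 < n)%N -> (1 <= p.2 < m.+2)%N ->
  P p x + (-1) ^+ s * 'i * \sum_(q <- node_idx m.+1)
     (cc q x * P p (tc q x) - P p x * cc q (ta p x)) * u q (ta p x) =
  Xfac c m.+1 s e (nu x (2 * m + 1)) (nu x (2 * m.+1)) (nu x (2 * m.+1 + 1)) p.
Proof.
move=> mn' jm; rewrite /Xfac; congr (_ + _ * _); apply: eq_big_seq => q qm.
rewrite /cc /P /u nu_ta_at // !nu_ta; try lia.
rewrite (@nu_tc _ _ (2 * m + 1)); last lia.
congr ((_ * Pcoef _ _ _ _ _ - _) * _).
case/node_idxP : qm => [->//|[e' [l [lm ->]]]].
by rewrite /tc /= nu_shift_eq // ?uphalf_even //; lia.
Qed.

(** With [-, B] alone the surviving terms keep P instead of X = 2 P, so the eigenvalue is half that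
    of [eigen_full]. This is the form needed at k = n. *)
Lemma eigen_right x : generic x ->
  I_odd c m.+1 w x + (-1) ^+ s * 'i * op_comm (I_odd c m.+1) (I_even c m) w x
  = - (-1) ^+ s / h * w x.
Proof.
move=> gx; have [g gm sk sm sn] := gen gx.
have := comm_op_right AE BE Ga Pb tab wa wb gx; rewrite /comm_op => E.
rewrite /op_comm E AE.
have -> : \sum_(p <- at_idx m) P p x * Q p x * w (ta p x) =
    (\sum_(p <- at_idx m) t p x * P p x * Q p x) * w x.
  by rewrite mulr_suml; apply: eq_big_seq => p pA; rewrite wa //; ring.
rewrite [X in _ + X]mulrA -mulrDl; congr (_ * w x).
rewrite mulr_sumr -big_split /= -(sum_collapse c0 g gm sk sm sn (layer_sign_exp R s m)) -/e.
rewrite (eq_big_seq (fun p => t p x * P p x *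
   Yfac c m s e (nu x (2 * m - 1)) (nu x (2 * m)) (nu x (2 * m + 1)) p)); last first.
  by move=> p /at_idxP jm; rewrite /= -YE //; ring.
rewrite (@sum_at_idx R m e) => [|p jm pe]; last first.
  have [m0 _] := gm _ jm.
  by rewrite (Yfac_eq0 c0 g sk sm jm m0 (layer_sign_exp R s m) pe) mulr0.
by apply: eq_bigr => j _; rewrite /t at_ratio_neg.
Qed.

(** This is [comm_op_factor] with parameter (-1)^s i, whose square is -1. The terms of direction e
    vanish through Y, the others carry X = 2 P, which gives twice [sum_collapse]. *)
Lemma eigen_full x : (m.+1 < n)%N -> generic x ->
  let A := I_odd c m.+1 in let B := I_even c m in let C := I_even c m.+1 in
  I_odd c m.+1 w x
    + (-1) ^+ s * 'i * (op_comm C A w x + op_comm A B w x)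
    - op_comm (op_comm C A) B w x
  = - (2 * (-1) ^+ s / h) * w x.
Proof.
move=> mn' gx A B C; have [g gm sk sm sn] := gen gx.
have cb q r y : cc q (tb r y) = cc q y by rewrite /cc !nu_tb //; lia.
have bc q r y : b r (tc q y) = b r y by rewrite /b !nu_tc //; lia.
have vc q r y : v r (tc q y) = v r y by rewrite /v !nu_tc //; lia.
have Qc p q y : Q p (tc q y) = Q p y by rewrite /Q !nu_tc //; lia.
have tac p q y : ta p (tc q y) = tc q (ta p y).
  by case: q => [[e' l]|] //; exact: nu_shiftC.
have tcb q r y : tc q (tb r y) = tb r (tc q y).
  by case: q r => [[e' l]|] // [[e'' l']|] //; exact: nu_shiftC.
have wc q y : q \in node_idx m.+1 -> generic y -> w (tc q y) = u q y * w y.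
  by move=> qm gy; rewrite /w whitt_node_shift // /u double_odd.
have := comm_op_factor AE BE CE Ga Gc Pb Qc cb bc vc tab tac tcb wa wb wc
  ((-1) ^+ s * 'i) gx.
have -> : ((-1) ^+ s * 'i) ^+ 2 = -1 :> K by rewrite exprMn sqrr_sign sqr_i mul1r.
rewrite mulN1r => ->; congr (_ * w x).
have sl : sep_layers m.+1 (nu x (2 * m.+1)) m.+2 (nu x (2 * m.+1 + 1)).
  by apply: sep_layers_generic => //; rewrite ?uphalf_even ?uphalf_odd //; lia.
have gn : gen_layer m.+1 (nu x (2 * m.+1)).
  by apply: gen_layer_generic => //; rewrite ?uphalf_even //; lia.
have sX : (-1) ^+ m.+1 = - ((-1) ^+ s * (-1) ^+ e) :> K.
  by rewrite exprS mulN1r (layer_sign_exp R s m).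
rewrite (eq_big_seq (fun p => t p x *
   Xfac c m.+1 s e (nu x (2 * m + 1)) (nu x (2 * m.+1)) (nu x (2 * m.+1 + 1)) p *
   Yfac c m s e (nu x (2 * m - 1)) (nu x (2 * m)) (nu x (2 * m + 1)) p)); last first.
  by move=> p /at_idxP jm; rewrite /= XE // YE.
rewrite (@sum_at_idx R m e) => [|p jm pe]; last first.
  have [m0 _] := gm _ jm.
  by rewrite (Yfac_eq0 c0 g sk sm jm m0 (layer_sign_exp R s m) pe) mulr0.
rewrite (_ : - _ = 2 * (- (-1) ^+ s / h)); last by ring.
rewrite -(sum_collapse c0 g gm sk sm sn (layer_sign_exp R s m)) -/e mulr_sumr.
apply: eq_big_nat => j jm; have [m0 _] := gm _ jm.
by rewrite (@Xfac_double R c c0 m.+1 s e _ _ _ (~~ e, j)) // /t at_ratio_neg; ring.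
Qed.

End Layer.

Lemma I_simple_even k : @I_simple R n c (2 * k) = I_odd c k.
Proof. by rewrite /I_simple oddM mul2n doubleK. Qed.

Lemma I_simple_odd k : @I_simple R n c (2 * k).+1 = I_even c k.
Proof. by rewrite /I_simple oddS oddM mul2n /= uphalf_double. Qed.

Lemma I_odd_simple k : @I_ R n c (2 * k + 1) (2 * k) = I_odd c k.
Proof. by rewrite /I_ addKn -I_simple_even. Qed.

Lemma I_comm_even k : @I_ R n c (2 * k + 2) (2 * k) = op_comm (I_even c k) (I_odd c k).
Proof. by rewrite /I_ addKn -I_simple_even -I_simple_odd. Qed.

Lemma I_comm_odd m : @I_ R n c (2 * m.+1 + 1) (2 * m.+1 - 1) =
  op_comm (I_odd c m.+1) (I_even c m).
Proof.
rewrite /I_ (_ : (2 * m.+1 + 1 - (2 * m.+1 - 1)).-1 = 1)%N; last by lia.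
by rewrite -I_simple_even -I_simple_odd (_ : 2 * m.+1 - 1 = (2 * m).+1)%N;
  [rewrite mulnSr addn2|lia].
Qed.

Lemma I_comm_double m : @I_ R n c (2 * m.+1 + 2) (2 * m.+1 - 1) =
  op_comm (op_comm (I_even c m.+1) (I_odd c m.+1)) (I_even c m).
Proof.
rewrite /I_ (_ : (2 * m.+1 + 2 - (2 * m.+1 - 1)).-1 = 2)%N; last by lia.
by rewrite -I_simple_even -!I_simple_odd (_ : 2 * m.+1 - 1 = (2 * m).+1)%N;
  [rewrite mulnSr addn2|lia].
Qed.

Lemma mero_eq_generic (f g : nu_space R n -> K) :
  (forall x, generic x -> f x = g x) -> mero_eq f g.
Proof.
by move=> fg; exists (@generic R n); split => //; [exact: open_generic|exact: dense_generic].
Qed.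

Lemma F_up_eigen k : (1 <= k < n)%N ->
  mero_eq (F_up c k (whitt c false)) (fun x : nu_space R n => - h^-1 * whitt c false x).
Proof.
case: k => // m /= mn; apply: mero_eq_generic => x gx.
rewrite /F_up mn I_odd_simple I_comm_even I_comm_odd I_comm_double.
have /= E := @eigen_full false m (ltnW mn) x mn gx; rewrite expr0 mul1r in E.
transitivity (2^-1 * (- (2 * 1 / h) * whitt c false x)); last by field; exact: h_neq0.
by rewrite -E; ring.
Qed.

(** For s = true the generator is -1/2 times the combination in [eigen_full]; this sign cancels the
    (-1)^s of the eigenvalue there. *)
Lemma F_down_eigen k : (1 <= k < n)%N ->
  mero_eq (F_down c k (whitt c true)) (fun x : nu_space R n => - h^-1 * whitt c true x).
Proof.
case: k => // m /= mn; apply: mero_eq_generic => x gx.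
rewrite /F_down mn I_odd_simple I_comm_even I_comm_odd I_comm_double.
have /= E := @eigen_full true m (ltnW mn) x mn gx; rewrite expr1 in E.
transitivity (- 2^-1 * (- (2 * -1 / h) * whitt c true x)); last by field; exact: h_neq0.
by rewrite -E; ring.
Qed.

Lemma eigen_last s x : (0 < n)%N -> generic x ->
  I_ c (2 * n + 1) (2 * n) (whitt c s) x
    + (-1) ^+ s * 'i * I_ c (2 * n + 1) (2 * n - 1) (whitt c s) x
  = - (-1) ^+ s / h * whitt c s x.
Proof.
move=> n0 gx; have [m nE] : exists m, n = m.+1 by exists n.-1; rewrite prednK.
have mn : (m < n)%N by rewrite nE.
have E := eigen_right s mn gx.
have i1 := I_odd_simple m.+1; have i2 := I_comm_odd m.
by rewrite -nE in E i1 i2; rewrite i1 i2.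
Qed.

Lemma F_up_last : (0 < n)%N ->
  mero_eq (F_up c n (whitt c false))
    (fun x : nu_space R n => - ((Num.sqrt 2)%:C * h)^-1 * whitt c false x).
Proof.
move=> n0; apply: mero_eq_generic => x gx; rewrite /F_up ltnn.
have := eigen_last false n0 gx; rewrite expr0 mul1r => ->.
by rewrite [in RHS]invfM -[in RHS]fmorphV; ring.
Qed.

Lemma F_down_last : (0 < n)%N ->
  mero_eq (F_down c n (whitt c true))
    (fun x : nu_space R n => - ((Num.sqrt 2)%:C * h)^-1 * whitt c true x).
Proof.
move=> n0; apply: mero_eq_generic => x gx; rewrite /F_down ltnn.
have E := eigen_last true n0 gx; rewrite expr1 in E.
transitivity (- (Num.sqrt 2)^-1%:C * (- -1 / h * whitt c true x)).
  by rewrite -E; ring.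
by rewrite [in RHS]invfM -[in RHS]fmorphV; ring.
Qed.

End Eigen.

(** The eigenvalue has the same sign for every k. Composing the action with the automorphism
    described at [F_up] multiplies it by (-1)^k, which gives the alternating signs (-1)^(k+1). *)
Theorem theorem1 (R : realType) (n : nat) (c : R) (hn : (1 <= n)%N)
    (hc : 0 < c) :
  [/\ forall k : nat, (1 <= k < n)%N ->
        mero_eq (F_up c k (@whittaker_w R n c))
                (fun x => - (ic c)^-1 * whittaker_w c x),
      mero_eq (F_up c n (@whittaker_w R n c))
              (fun x => - ((Num.sqrt 2)%:C * ic c)^-1 * whittaker_w c x),
      forall k : nat, (1 <= k < n)%N ->
        mero_eq (F_down c k (@whittaker_w' R n c))
                (fun x => - (ic c)^-1 * whittaker_w' c x)
    & mero_eq (F_down c n (@whittaker_w' R n c))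
              (fun x => - ((Num.sqrt 2)%:C * ic c)^-1 * whittaker_w' c x)].
Proof.
have -> : @whittaker_w R n c = whitt c false by apply/funext => x; exact: whitt_false.
have -> : @whittaker_w' R n c = whitt c true by apply/funext => x; exact: whitt_true.
split; [exact: F_up_eigen|exact: F_up_last|exact: F_down_eigen|exact: F_down_last].
Qed.
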